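(* Suppose $f(i,y,z)$ is convex in $(y,z)$ for every $i$ and $\omega$. Then for every $i=0,\ldots,n$, $$Y_i=\operatorname*{ess\,inf}_{(M^0,M)\in\mathcal M_{1+D}}E_i[\theta^{up}_i(M^0,M)].$$ Moreover, if $M^{0,*}$ is the Doob martingale of $Y$ and $M^*$ is the Doob martingale of $(\beta_jY_j)_j$ (with $\beta_0:=0$), then $(M^{0,*},M^* )\in\mathcal M_{1+D}$ and $\theta^{up}_i(M^{0,*},M^* )=Y_i$ $P$-almost surely for every $i$.
   Context: Standing setting: $n\ge 1$ and $D\ge 1$ are integers; $(\Omega,\mathcal F,(\mathcal F_i)_{i=0,\ldots,n},P)$ is a filtered probability space and $E_i[\cdot]=E[\cdot\mid\mathcal F_i]$. The constants $\Delta_0,\ldots,\Delta_{n-1}$ are positive reals. $S=(S_i)_{i=0,\ldots,n}$ is an adapted process with values in $\mathbb R\cup\{-\infty\}$, $S_n$ real-valued, with $\sum_{i=0}^{n-1}E[|S_i\mathbf 1_{\{S_i>-\infty\}}|]+E[|S_n|]<\infty$. The random field $f:\Omega\times\{0,\ldots,n-1\}\times\mathbb R\times\mathbb R^D\to\mathbb R$ is measurable, $f(\cdot,i,y,z)$ is $\mathcal F_i$-measurable for every $(y,z)$ (the dependence on $\omega$ is suppressed), $\sum_{i=0}^{n-1}E[|f(i,0,0)|]<\infty$, and there are adapted nonnegative processes $\alpha^{(0)},\ldots,\alpha^{(D)}$ with $|f(i,y,z)-f(i,y',z')|\le\alpha^{(0)}_i|y-y'|+\sum_{d=1}^D\alpha^{(d)}_i|z_d-z'_d|$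 for all $(y,z),(y',z')\in\mathbb R\times\mathbb R^D$. $\beta=(\beta_i)_{i=1,\ldots,n}$ is a bounded adapted $\mathbb R^D$-valued process, and for $i=0,\ldots,n-1$ almost surely $\alpha^{(0)}_i<1/\Delta_i$ and $\sum_{d=1}^D\alpha^{(d)}_i|\beta_{d,i+1}|\le 1/\Delta_i$. $Y$ denotes the unique adapted integrable process with $Y_n=S_n$ and $Y_i=\max\{S_i,\;E_i[Y_{i+1}]+f(i,Y_i,E_i[\beta_{i+1}Y_{i+1}])\Delta_i\}$ for $i=0,\ldots,n-1$. The Doob martingale of an integrable adapted process $V$ is $N_i=\sum_{j=0}^{i-1}(V_{j+1}-E_j[V_{j+1}])$. $\mathcal M_{1+D}$ is the set of pairs $(M^0,M)$ where $M^0$ is a real-valued martingale and $M=(M_1,\ldots,M_D)$ an $\mathbb R^D$-valued martingale with $\sum_{d=1}^D\sum_{i=0}^{n-1}E[\alpha^{(d)}_i|M_{d,i+1}-M_{d,i}|]\Delta_i<\infty$. For $(M^0,M)\in\mathcal M_{1+D}$, the (non-adapted) process $\theta^{up}=\theta^{up}(M^0,M)$ is defined pathwise by $\theta^{up}_n=S_n$ and, for $i=n-1,\ldots,0$, as the unique solution (it exists since $\alpha^{(0)}_i\Delta_i<1$) of $$\theta^{up}_i=\max\{S_i,\;\theta^{up}_{i+1}-(M^0_{i+1}-M^0_i)+f(i,\theta^{up}_i,\beta_{i+1}\theta^{up}_{i+1}-(M_{i+1}-M_i))\Delta_i\}.$$ *)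

(* Defs.v *)
From HB Require Import structures.
From mathcomp Require Import all_boot all_order all_algebra.
From mathcomp Require Import all_classical all_reals all_analysis.
From mathcomp Require Import measurable_realfun.
Set Implicit Arguments. Unset Strict Implicit. Unset Printing Implicit Defensive.
Import Order.TTheory GRing.Theory Num.Theory.
Import numFieldNormedType.Exports.
Local Open Scope classical_set_scope.
Local Open Scope ring_scope.

Section Defs.
Context {d : measure_display} {T : measurableType d} {R : realType}.

Definition Fmeas (G : set (set T)) (X : T -> R) : Prop :=
  forall B : set R, measurable B -> G (X @^-1` B).

Definition Fmeas_e (G : set (set T)) (X : T -> \bar R) : Prop :=
  forall B : set (\bar R), measurable B -> G (X @^-1` B).

Definition filtration (n : nat) (F : nat -> set (set T)) : Prop :=
  (forall i, (i <= n)%N -> sigma_algebra setT (F i)) /\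
  (forall i, (i <= n)%N -> F i `<=` measurable) /\
  (forall i j, (i <= j <= n)%N -> F i `<=` F j).

Definition cexp (P : probability T R) (G : set (set T)) (X C : T -> R) : Prop :=
  P.-integrable setT (EFin \o X) /\
  Fmeas G C /\ P.-integrable setT (EFin \o C) /\
  (forall A, G A -> (\int[P]_(x in A) (C x)%:E = \int[P]_(x in A) (X x)%:E)%E).

Definition cexp_nn (P : probability T R) (G : set (set T)) (X C : T -> \bar R)
  : Prop :=
  Fmeas_e G C /\ (forall x, (0 <= C x)%E) /\
  (forall A, G A -> (\int[P]_(x in A) C x = \int[P]_(x in A) X x)%E).

(* generalized conditional expectation E[X|G] := E[X^+|G] - E[X^-|G],
   with the convention +oo - (+oo) := +oo *)
Definition gcexp (P : probability T R) (G : set (set T)) (X : T -> R)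
  (C : T -> \bar R) : Prop :=
  exists Cp Cn : T -> \bar R,
    cexp_nn P G (fun x => (Num.max (X x) 0)%:E) Cp /\
    cexp_nn P G (fun x => (Num.max (- X x) 0)%:E) Cn /\
    (forall x, C x = if Cp x == +oo%E then +oo%E else (Cp x - Cn x)%E).

Definition is_mart (P : probability T R) (n : nat) (F : nat -> set (set T))
  (M : nat -> T -> R) : Prop :=
  (forall i, (i <= n)%N -> Fmeas (F i) (M i)) /\
  (forall i, (i <= n)%N -> P.-integrable setT (EFin \o M i)) /\
  (forall i, (i < n)%N -> cexp P (F i) (M i.+1) (M i)).

Definition MartClass (P : probability T R) (n D : nat) (F : nat -> set (set T))
  (alpha : 'I_D -> nat -> T -> R) (Delta : nat -> R)
  (M0 : nat -> T -> R) (M : 'I_D -> nat -> T -> R) : Prop :=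
  is_mart P n F M0 /\ (forall k, is_mart P n F (M k)) /\
  (\sum_(k < D) \sum_(i < n)
     (\int[P]_x (alpha k i x * `|M k i.+1 x - M k i x|)%:E) * (Delta i)%:E
     < +oo)%E.

(* one backward step of theta^up at time i < n and state x, given
   next = theta^up_{i+1}(x): the unique solution t of
   t = max{S_i, next - (M0_{i+1}-M0_i) + f(i,t, beta_{i+1} next - (M_{i+1}-M_i)) Delta_i},
   which exists when alpha0_i Delta_i < 1 (this holds a.s.); elsewhere 0. *)
Definition theta_step (D : nat) (S : nat -> T -> \bar R)
  (f : nat -> T -> R -> 'rV[R]_D -> R) (alpha0 : nat -> T -> R)
  (beta : 'I_D -> nat -> T -> R) (Delta : nat -> R)
  (M0 : nat -> T -> R) (M : 'I_D -> nat -> T -> R)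
  (i : nat) (x : T) (next : R) : R :=
  if alpha0 i x * Delta i < 1 then
    xget 0 [set t : R | t%:E = Order.max (S i x)
      ((next - (M0 i.+1 x - M0 i x)
        + f i x t (\row_(k < D) (beta k i.+1 x * next - (M k i.+1 x - M k i x)))
          * Delta i)%:E)]
  else 0.

(* theta_rec k = theta^up_{n-k} *)
Fixpoint theta_rec (n D : nat) (S : nat -> T -> \bar R)
  (f : nat -> T -> R -> 'rV[R]_D -> R) (alpha0 : nat -> T -> R)
  (beta : 'I_D -> nat -> T -> R) (Delta : nat -> R)
  (M0 : nat -> T -> R) (M : 'I_D -> nat -> T -> R) (k : nat) : T -> R :=
  match k with
  | 0 => fun x => fine (S n x)
  | k'.+1 => fun x => theta_step S f alpha0 beta Delta M0 M (n - k'.+1) x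
                        (theta_rec n S f alpha0 beta Delta M0 M k' x)
  end.

Definition theta_up (n D : nat) (S : nat -> T -> \bar R)
  (f : nat -> T -> R -> 'rV[R]_D -> R) (alpha0 : nat -> T -> R)
  (beta : 'I_D -> nat -> T -> R) (Delta : nat -> R)
  (M0 : nat -> T -> R) (M : 'I_D -> nat -> T -> R) (i : nat) : T -> R :=
  theta_rec n S f alpha0 beta Delta M0 M (n - i).

End Defs.

(* Main.v *)
Require Import Defs.
From HB Require Import structures.
From mathcomp Require Import all_boot all_order all_algebra.
From mathcomp Require Import all_classical all_reals all_analysis.
From mathcomp Require Import measurable_realfun.
From mathcomp Require Import ring lra.
Import Order.TTheory GRing.Theory Num.Theory.
Import numFieldNormedType.Exports.
Local Open Scope classical_set_scope.
Local Open Scope ring_scope.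

(** Lower bound.  Pick a measurable subgradient of [f i] at
    [(Y_i, E_i[beta_{i+1} Y_{i+1}])].  Linearizing the recursion of [theta^up]
    on [{S_i < Y_i}] gives [theta^up_i >= Y_i + L_i], where [L_n = 0] and
    [L_i] is a nonnegative [F_i]-measurable multiple of
    [c L_{i+1} + m_{i+1}], with [c >= 0] being [F_{i+1}]-measurable and
    [m_{i+1}] an integrable martingale difference.  Unbounded weights make
    [L_i] non-integrable in general, so one propagates only
    [E_i[L_i^-] <= E_i[L_i^+]], which is stable under both operations.  This
    needs no measurability of [theta^up], because the integral of a nonnegative
    function is a supremum over simple functions, hence monotone.

    Optimality.  With the Doob martingales the pathwise recursion at
    [theta^up_{i+1} = Y_{i+1}] becomes the equation defining [Y_i], and its
    solution is unique because [alpha^(0)_i Delta_i < 1]. *)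

(** Let [r^0, r^d] be the subgradient coordinates. On [{S_i < Y_i}] linearization gives [(1 - r^0
    Delta_i) (theta_i - Y_i) >= c (theta_{i+1} - Y_{i+1}) + m_{i+1}] with
    [c = 1 + Delta_i sum_d r^d beta_{d,i+1}]. Since [|r^d| <= alpha^(d)], the two assumptions on the
    coefficients are sign conditions: the one on [alpha^(0)] makes the left factor positive, so that
    division is allowed, and the one on [sum_d alpha^(d) |beta_d|] makes [c] nonnegative, so that a
    lower bound for [theta_{i+1}] can be inserted. Elsewhere [theta_i >= S_i] already suffices and
    the weight is 0. The base point is chosen so that every error term in [m_{i+1}] is a martingale
    difference: those of [Y] and [beta Y], and those of [M^0] and [M]. Their weights are dominated
    by [alpha^(d)], and this is where the bound on [alpha |beta|] and the summability in the class
    give integrability. The weights must be [F_i]-measurable, so a subgradient chosen separately for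
    each [omega] is not enough. It is produced by countable limits of difference quotients, taken
    along one basis vector after another. *)

(** * One-sided directional derivatives of convex functions *)

Section Subgradient.
Context {R : realType} {V : lmodType R}.
Implicit Types (h l : V -> R) (u v w : V).

Definition convex_fct h := forall u v (t : R), 0 <= t <= 1 ->
  h (t *: u + (1 - t) *: v) <= t * h u + (1 - t) * h v.

Definition sublinear l := (forall u v, l (u + v) <= l u + l v) /\
  (forall (t : R) v, 0 <= t -> l (t *: v) = t * l v).

(** The step runs through [1/(m+1)], so that the one-sided derivative is the limit of a sequence and
    inherits measurability in a parameter. *)
Definition dir_quot h w v (m : nat) : R :=
  m.+1%:R * (h (w + m.+1%:R^-1 *: v) - h w).

Definition dir_deriv h w v : R := limn (dir_quot h w v).

Lemma sublinear_convex l : sublinear l -> convex_fct l.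
Proof.
move=> [lD lZ] u v t /andP[t0 t1]; rewrite -!lZ ?subr_ge0//; exact: lD.
Qed.

(** [w + s v] is the convex combination of [w + t v] and [w] with weight [s / t]. Slopes are
    compared after clearing denominators. *)
Lemma convex_slope h w v (s t : R) : convex_fct h -> 0 < s -> s <= t ->
  t * (h (w + s *: v) - h w) <= s * (h (w + t *: v) - h w).
Proof.
move=> hc s0 st; have t0 : 0 < t by exact: lt_le_trans st.
have st01 : 0 <= s / t <= 1.
  by rewrite ler_pdivrMr// mul1r st andbT divr_ge0// ltW.
have := hc (w + t *: v) w (s / t) st01.
have -> : (s / t) *: (w + t *: v) + (1 - s / t) *: w = w + s *: v.
  rewrite scalerDr scalerA divfK ?gt_eqF// scalerBl scale1r addrCA addrAC.
  by rewrite subrr add0r addrC.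
move=> H.
have := ler_wpM2l (ltW t0) H; set a := h _; set b := h _; set c := h w.
have -> : t * (s / t * b + (1 - s / t) * c) = s * b + (t - s) * c.
  by field; rewrite gt_eqF.
by move=> ?; nra.
Qed.

(** [w] is the convex combination of [w + s v] and [w - v] with weight [1/(1+s)]. The backward slope
    thus bounds all forward quotients from below, which makes their decreasing sequence converge. *)
Lemma convex_slope_opp h w v (s : R) : convex_fct h -> 0 < s ->
  s * (h w - h (w - v)) <= h (w + s *: v) - h w.
Proof.
move=> hc s0; have s10 : 0 < 1 + s by rewrite addr_gt0.
have s01 : 0 <= (1 + s)^-1 <= 1.
  by rewrite invf_le1// lerDl invr_ge0 !ltW.
have := hc (w + s *: v) (w - v) _ s01.
have e : 1 - (1 + s)^-1 = s * (1 + s)^-1 by field; rewrite gt_eqF.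
rewrite e.
have -> : (1 + s)^-1 *: (w + s *: v) + (s * (1 + s)^-1) *: (w - v) = w.
  rewrite scalerDr scalerBr scalerA [(1 + s)^-1 * s]mulrC addrACA subrr addr0.
  by rewrite -scalerDl -{1}[(1+s)^-1]mul1r -mulrDl divff ?gt_eqF// scale1r.
move=> H.
have := ler_wpM2l (ltW s10) H; set a := h _; set b := h _; set c := h (w - v).
have -> : (1 + s) * ((1 + s)^-1 * b + s * (1 + s)^-1 * c) = b + s * c.
  by field; rewrite gt_eqF.
by move=> ?; nra.
Qed.

Lemma dir_quot_nonincreasing h w v : convex_fct h ->
  {homo dir_quot h w v : m k / (m <= k)%N >-> k <= m}.
Proof.
move=> hc m k mk.
have mk' : (k.+1%:R^-1 <= m.+1%:R^-1 :> R) by rewrite lef_pV2 ?posrE// ler_nat.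
have := convex_slope h w v _ _ hc _ mk'; rewrite invr_gt0 ltr0n => /(_ isT) H.
have := ler_wpM2l (mulr_ge0 (ler0n R k.+1) (ler0n R m.+1)) H.
rewrite mulrA mulfK ?pnatr_eq0// => /le_trans; apply.
by rewrite mulrA [k.+1%:R * _]mulrC mulfK ?pnatr_eq0.
Qed.

Lemma dir_quot_cvg h w v : convex_fct h -> cvgn (dir_quot h w v).
Proof.
move=> hc; apply: nonincreasing_is_cvgn; first exact: dir_quot_nonincreasing.
exists (h w - h (w - v)) => _ [m _ <-].
have m0 : 0 < (m.+1%:R^-1 : R) by rewrite invr_gt0.
have := ler_wpM2l (ler0n R m.+1) (convex_slope_opp h w v _ hc m0).
by rewrite mulrA divff ?pnatr_eq0// mul1r.
Qed.

Lemma dir_deriv_le h w v (s : R) : convex_fct h -> 0 < s ->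
  s * dir_deriv h w v <= h (w + s *: v) - h w.
Proof.
move=> hc s0.
have [m ms] : exists m, m.+1%:R^-1 <= s.
  exists (Num.truncn s^-1); rewrite invf_ple ?posrE//.
  exact: ltW (truncnS_gt _).
have m0 : 0 < (m.+1%:R^-1 : R) by rewrite invr_gt0.
have := nonincreasing_cvgn_ge (dir_quot_nonincreasing h w v hc)
  (dir_quot_cvg h w v hc) m.
rewrite -(ler_pM2l s0) => /le_trans; apply.
have := ler_wpM2l (ler0n R m.+1) (convex_slope h w v _ _ hc m0 ms).
rewrite /dir_quot [X in _ <= X -> _]mulrA divff ?pnatr_eq0// mul1r.
by rewrite mulrCA.
Qed.

Lemma dir_deriv_ge h w v (B : R) : convex_fct h ->
  (forall s : R, 0 < s -> s * B <= h (w + s *: v) - h w) -> B <= dir_deriv h w v.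
Proof.
move=> hc HB; apply: limr_ge; first exact: dir_quot_cvg.
apply: nearW => m; have m0 : 0 < (m.+1%:R^-1 : R) by rewrite invr_gt0.
have := ler_wpM2l (ler0n R m.+1) (HB _ m0).
by rewrite mulrA divff ?pnatr_eq0// mul1r.
Qed.

Lemma dir_derivZ h w v (t : R) : convex_fct h -> 0 <= t ->
  dir_deriv h w (t *: v) = t * dir_deriv h w v.
Proof.
move=> hc; rewrite le_eqVlt => /predU1P[<-|t0].
  rewrite mul0r scale0r; apply/eqP; rewrite eq_le; apply/andP; split.
    have := dir_deriv_le h w 0 1 hc ltr01.
    by rewrite scaler0 addr0 subrr mul1r.
  by apply: dir_deriv_ge => // s s0; rewrite scaler0 addr0 subrr mulr0.
(* This inequality, used for the factor [t] at [v] and for [t^-1] at [t *: v], gives both halves of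
   homogeneity. *)
have H (u : V) (r : R) : 0 < r -> r * dir_deriv h w u <= dir_deriv h w (r *: u).
  move=> r0; apply: dir_deriv_ge => // s s0; rewrite mulrA scalerA.
  by apply: dir_deriv_le => //; rewrite mulr_gt0.
apply/eqP; rewrite eq_le H// andbT -ler_pdivrMl//.
have := H (t *: v) t^-1; rewrite invr_gt0 => /(_ t0) /le_trans; apply.
by rewrite scalerA mulVf ?scale1r// gt_eqF.
Qed.

(** The midpoint of [w + u/(m+1)] and [w + v/(m+1)] lies on the ray along [u + v] at half the step,
    so the two quotients together dominate a quotient of [u + v], hence its derivative. *)
Lemma dir_derivD h w u v : convex_fct h ->
  dir_deriv h w (u + v) <= dir_deriv h w u + dir_deriv h w v.
Proof.
move=> hc; rewrite /dir_deriv -limD; try exact: dir_quot_cvg.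
apply: limr_ge; first by apply: is_cvgD; exact: dir_quot_cvg.
apply: nearW => m; rewrite -/(dir_deriv h w (u + v)) /dir_quot /=.
set r : R := m.+1%:R; have r0 : 0 < r by rewrite ltr0n.
have r20 : 0 < (2 * r)^-1 by rewrite invr_gt0 mulr_gt0.
have := dir_deriv_le h w (u + v) _ hc r20.
have h01 : 0 <= (2^-1 : R) <= 1 by rewrite invr_ge0 ler0n/= invf_le1// ler1n.
have := hc (w + r^-1 *: u) (w + r^-1 *: v) _ h01.
have e2 : 1 - 2^-1 = (2^-1 : R) by field.
have -> : 2^-1 *: (w + r^-1 *: u) + (1 - 2^-1) *: (w + r^-1 *: v) =
    w + (2 * r)^-1 *: (u + v).
  rewrite e2 -scalerDr addrACA -mulr2n -[w *+ 2]scaler_nat scalerDr !scalerA.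
  by rewrite mulVf ?pnatr_eq0// scale1r -scalerDr scalerA invfM.
rewrite e2.
set a := h _; set b := h (_ + _ *: u); set c := h (_ + _ *: v).
set e := dir_deriv _ _ _ => H1 H2.
have := ler_wpM2l (ltW (mulr_gt0 (ltr0Sn R 1) r0)) (le_trans H2 (lerB H1 (lexx (h w)))).
rewrite mulrA divff ?mul1r ?gt_eqF ?mulr_gt0//; move=> /le_trans; apply.
by rewrite fctE -/r -/b -/c le_eqVlt; apply/orP; left; apply/eqP; field.
Qed.

Lemma sublinear_dir_deriv h w : convex_fct h -> sublinear (dir_deriv h w).
Proof.
by move=> hc; split=> *; [exact: dir_derivD | exact: dir_derivZ].
Qed.

End Subgradient.

(** * Measurability with respect to a sub-sigma-algebra *)

Section SubSigmaAlgebra.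
Context {d : measure_display} {T : measurableType d} {R : realType}.
Implicit Types (G : set (set T)) (X : T -> R).

(** A sigma-algebra generates itself, so [G]-measurability is measurability on
    [g_sigma_algebraType G] and inherits the general closure properties. *)
Lemma measurable_g_sigma G (A : set T) : sigma_algebra setT G ->
  measurable (A : set (g_sigma_algebraType G)) = G A.
Proof. by move=> sG; rewrite -[in RHS](sigma_algebra_id sG). Qed.

Lemma FmeasP G X : sigma_algebra setT G ->
  Fmeas G X <-> measurable_fun setT (X : g_sigma_algebraType G -> R).
Proof.
move=> sG; split=> [mX _ B mB|mX B mB].
  by rewrite setTI measurable_g_sigma//; exact: mX.
by rewrite -measurable_g_sigma// -[X in measurable X]setTI; exact: mX.
Qed.

Lemma Fmeas_eP G (X : T -> \bar R) : sigma_algebra setT G ->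
  Fmeas_e G X <-> measurable_fun setT (X : g_sigma_algebraType G -> \bar R).
Proof.
move=> sG; split=> [mX _ B mB|mX B mB].
  by rewrite setTI measurable_g_sigma//; exact: mX.
by rewrite -measurable_g_sigma// -[X in measurable X]setTI; exact: mX.
Qed.

Lemma Fmeas_sub G H X : G `<=` H -> Fmeas G X -> Fmeas H X.
Proof. by move=> GH mX B /mX /GH. Qed.

Lemma Fmeas_measurable G X : G `<=` measurable -> Fmeas G X ->
  measurable_fun setT X.
Proof. by move=> GT mX _ B mB; rewrite setTI; exact/GT/mX. Qed.

Lemma Fmeas_e_measurable G (X : T -> \bar R) : G `<=` measurable ->
  Fmeas_e G X -> measurable_fun setT X.
Proof. by move=> GT mX _ B mB; rewrite setTI; exact/GT/mX. Qed.

Lemma FmeasB G X X' : sigma_algebra setT G -> Fmeas G X -> Fmeas G X' ->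
  Fmeas G (fun x => X x - X' x).
Proof.
by move=> sG /FmeasP-/(_ sG) mX /FmeasP-/(_ sG) mX'; apply/FmeasP => //;
  exact: measurable_funB.
Qed.

Lemma FmeasD G X X' : sigma_algebra setT G -> Fmeas G X -> Fmeas G X' ->
  Fmeas G (fun x => X x + X' x).
Proof.
by move=> sG /FmeasP-/(_ sG) mX /FmeasP-/(_ sG) mX'; apply/FmeasP => //;
  exact: measurable_funD.
Qed.

Lemma FmeasM G X X' : sigma_algebra setT G -> Fmeas G X -> Fmeas G X' ->
  Fmeas G (fun x => X x * X' x).
Proof.
by move=> sG /FmeasP-/(_ sG) mX /FmeasP-/(_ sG) mX'; apply/FmeasP => //;
  exact: measurable_funM.
Qed.

Lemma Fmeas_cst G (c : R) : sigma_algebra setT G -> Fmeas G (fun=> c).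
Proof. by move=> sG; apply/FmeasP => //; exact: measurable_cst. Qed.

Lemma Fmeas_sum (I : Type) (r : seq I) G (X : I -> T -> R) :
  sigma_algebra setT G -> (forall i, Fmeas G (X i)) ->
  Fmeas G (fun x => \sum_(i <- r) X i x).
Proof.
move=> sG mX; elim: r => [|i r IH].
  by under eq_fun do rewrite big_nil; exact: Fmeas_cst.
by under eq_fun do rewrite big_cons; exact: FmeasD.
Qed.

Lemma Fmeas_comp G X (g : R -> R) : measurable_fun setT g -> Fmeas G X ->
  Fmeas G (g \o X).
Proof.
move=> mg mX B mB; apply: (mX (g @^-1` B)).
by rewrite -[X in measurable X]setTI; exact: mg.
Qed.

Lemma Fmeas_cvg G (X_ : nat -> T -> R) X : sigma_algebra setT G ->
  (forall m, Fmeas G (X_ m)) -> (forall x, X_ ^~ x @ \oo --> X x) -> Fmeas G X.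
Proof.
move=> sG mX cX; apply/FmeasP => //.
apply: (@measurable_fun_cvg _ (g_sigma_algebraType G) R setT X_ X) => [m|x _];
  last exact: cX.
by apply/FmeasP.
Qed.

Lemma Fmeas_bigcup G (A : int -> set T) : sigma_algebra setT G ->
  (forall z, G (A z)) -> G (\bigcup_z A z).
Proof.
move=> sG GA; rewrite -measurable_g_sigma//.
apply: countable_bigcupT_measurable => //= z.
by rewrite measurable_g_sigma.
Qed.

(* Rounding [u] to the grid of mesh 1/(m+1) makes the composite a countable
   gluing of the measurable maps [h ^~ y]; Lipschitz continuity gives the limit. *)
Lemma Fmeas_caratheodory1 G (h : T -> R -> R) (u : T -> R) (K : T -> R) :
  sigma_algebra setT G ->
  (forall y, Fmeas G (h ^~ y)) ->
  (forall x y y', `|h x y - h x y'| <= K x * `|y - y'|) ->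
  Fmeas G u -> Fmeas G (fun x => h x (u x)).
Proof.
move=> sG mh hK mu.
pose q m x : R := (Num.floor (m.+1%:R * u x))%:~R / m.+1%:R.
have qu m x : `|q m x - u x| <= m.+1%:R^-1.
  have m0 : 0 < m.+1%:R :> R by rewrite ltr0n.
  rewrite -(ler_pM2l m0) divff ?gt_eqF// -[X in X * _]gtr0_norm// -normrM.
  rewrite mulrBr mulrCA divff ?gt_eqF// mulr1.
  by rewrite ler_norml; have := floor_itv (m.+1%:R * u x); rewrite intrD1; lra.
apply: (Fmeas_cvg G (fun m x => h x (q m x))) => // [m B mB|x]; last first.
  apply/cvgrPdist_le => e e0.
  have K0 : 0 < `|K x| + 1 by rewrite ltr_pwDr.
  have e0' : 0 < e / (`|K x| + 1) by rewrite divr_gt0.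
  near=> m; rewrite distrC (le_trans (hK _ _ _))//.
  rewrite (@le_trans _ _ ((`|K x| + 1) * m.+1%:R^-1))//.
    apply: ler_pM => //.
      by have := le_trans (normr_ge0 _) (hK x 1 0); rewrite subr0 normr1 mulr1.
    by rewrite (le_trans (ler_norm _))// lerDl.
  rewrite mulrC -ler_pdivlMr//; apply: ltW.
  by near: m; exact: (near_infty_natSinv_lt (PosNum e0')).
rewrite (_ : _ @^-1` _ = \bigcup_z
  (u @^-1` [set` `[z%:~R / m.+1%:R, (z + 1)%:~R / m.+1%:R[] `&` (h ^~ (z%:~R / m.+1%:R)) @^-1` B)).
  apply: Fmeas_bigcup => // z; rewrite -measurable_g_sigma//.
  by apply: measurableI; rewrite measurable_g_sigma//; [apply: mu|apply: mh].
have m0 : 0 < m.+1%:R :> R by rewrite ltr0n.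
apply/seteqP; split => [x /= hx|x [z _ [/=]]].
  exists (Num.floor (m.+1%:R * u x)) => //; split => //=.
  rewrite in_itv/= ler_pdivrMr// ltr_pdivlMr// ![u x * _]mulrC.
  exact: floor_itv.
rewrite in_itv/= ler_pdivrMr// ltr_pdivlMr// ![u x * _]mulrC => zu.
by rewrite /q (floor_def zu).
Unshelve. all: end_near.
Qed.

End SubSigmaAlgebra.

(** * A measurable choice of subgradients *)

Section MeasurableSubgradient.
Context {d : measure_display} {T : measurableType d} {R : realType}.
Variables (G : set (set T)) (sG : sigma_algebra setT G).

(** The scalar case is applied to one argument at a time: in [r m z] the first [m] coordinates are
    already random and the others are frozen at [z]; the argument [y] comes last. *)
Lemma Fmeas_caratheodory (D : nat) (f : T -> R -> 'rV[R]_D -> R)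
    (a0 : T -> R) (a : 'I_D -> T -> R) (u : T -> R) (v : 'I_D -> T -> R) :
  (forall y z, Fmeas G (fun x => f x y z)) ->
  (forall x y y' (z z' : 'rV[R]_D), `|f x y z - f x y' z'| <=
     a0 x * `|y - y'| + \sum_(k < D) a k x * `|z ord0 k - z' ord0 k|) ->
  Fmeas G u -> (forall k, Fmeas G (v k)) ->
  Fmeas G (fun x => f x (u x) (\row_k v k x)).
Proof.
move=> mf fL mu mv.
pose r (m : nat) (z : 'rV[R]_D) x : 'rV[R]_D :=
  \row_k (if (k < m)%N then v k x else z ord0 k).
have H m : (m <= D)%N -> forall y z, Fmeas G (fun x => f x y (r m z x)).
  elim: m => [_ y z|m IH mD y z].
    rewrite (_ : (fun _ => _) = (fun x => f x y z))//.
    by apply/funext => x; congr (f _ _ _); apply/rowP => k; rewrite mxE.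
  pose o := Ordinal mD.
  pose h x t := f x y (r m (\row_k (if k == o then t else z ord0 k)) x).
  rewrite (_ : (fun _ => _) = (fun x => h x (v o x))); last first.
    apply/funext => x; congr (f _ _ _); apply/rowP => k; rewrite !mxE ltnS.
    rewrite leq_eqVlt -(inj_eq val_inj) /=; case: ltngtP => //= km.
    by congr (v _ x); apply/val_inj.
  apply: (Fmeas_caratheodory1 G h (v o) (a o)) => //.
    by move=> t; exact: IH (ltnW mD) _ _.
  move=> x t t'; rewrite (le_trans (fL _ _ _ _ _))// subrr normr0 mulr0 add0r.
  rewrite (bigD1 o)//= big1 => [|k ko]; rewrite !mxE ?ltnn ?eqxx ?addr0//.
  by rewrite (negbTE ko) subrr normr0 mulr0.
pose h x t := f x t (\row_k v k x).
apply: (Fmeas_caratheodory1 G h u a0) => // [y|x y y'].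
  have := H D (leqnn D) y 0; rewrite /h; congr Fmeas; apply/funext => x.
  by congr (f _ _ _); apply/rowP => k; rewrite !mxE ltn_ord.
rewrite (le_trans (fL _ _ _ _ _))// [X in _ + X]big1 ?addr0// => k _.
by rewrite subrr normr0 mulr0.
Qed.

Lemma Fmeas_dir_deriv (V : lmodType R) (h : T -> V -> R) (w v : V) :
  (forall x, convex_fct (h x)) -> (forall v, Fmeas G (h ^~ v)) ->
  Fmeas G (fun x => dir_deriv (h x) w v).
Proof.
move=> hc mh; apply: (Fmeas_cvg G (fun m x => dir_quot (h x) w v m)) => // [m|x].
  apply: FmeasM => //; first exact: Fmeas_cst.
  by apply: FmeasB => //; exact: mh.
exact: dir_quot_cvg.
Qed.

(* Differentiating a sublinear function at [e] makes it linear along [e] and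
   only decreases it, so that linearity along earlier directions is kept. *)
Lemma sublinear_minorant (V : lmodType R) (h : T -> V -> R) (es : seq V) :
  (forall x, sublinear (h x)) -> (forall v, Fmeas G (h ^~ v)) ->
  exists l : T -> V -> R, [/\ forall x, sublinear (l x),
    forall v, Fmeas G (l ^~ v), forall x v, l x v <= h x v &
    forall x e, e \in es -> l x (- e) = - l x e].
Proof.
elim: es h => [|e es IH] h hs mh; first by exists h.
have hc x : convex_fct (h x) by exact: sublinear_convex.
have [||l [ls ml lh le]] := IH (fun x => dir_deriv (h x) e).
- by move=> x; exact: sublinear_dir_deriv.
- by move=> v; exact: Fmeas_dir_deriv.
have dh x v : dir_deriv (h x) e v <= h x v.
  have := dir_deriv_le (h x) e v 1 (hc x) ltr01.
  by rewrite mul1r scale1r => /le_trans; apply; rewrite lerBlDl (hs x).1.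
exists l; split => // [x v|x e']; first exact: le_trans (lh x v) (dh x v).
rewrite inE => /predU1P[->|]; last exact: le.
have [lD lZ] := ls x.
apply/eqP; rewrite eq_le; apply/andP; split; last first.
  rewrite -subr_ge0 opprK (le_trans _ (lD _ _))// addNr -(scale0r (0 : V)).
  by rewrite lZ// mul0r.
(* With step 1/2, [e - e/2] is a positive multiple of [e], and homogeneity bounds the derivative
   along [- e] by [- h x e]. *)
have h2 : 0 < (2^-1 : R) by rewrite invr_gt0 ltr0n.
have := dir_deriv_le (h x) e (- e) 2^-1 (hc x) h2.
have -> : e + 2^-1 *: - e = 2^-1 *: e :> V.
  rewrite -{1}(scale1r e) scalerN -scalerBl; congr (_ *: _).
  by field.
rewrite (hs x).2; last exact: ltW.
move=> H1; have := lh x (- e); have := le_trans (lh x e) (dh x e).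
by lra.
Qed.

(** A finite-dimensional Hahn-Banach argument with a parameter: the derivative at the base point is
    sublinear, and a minorant that is odd along the basis [e0], [e k] has the subgradient as its
    values there. The bounds by [a0] and [a k] hold because this minorant lies below the increments
    of [f] along both signs of each basis vector. *)
Lemma measurable_subgradient (D : nat) (f : T -> R -> 'rV[R]_D -> R)
    (a0 : T -> R) (a : 'I_D -> T -> R) (u : T -> R) (v : 'I_D -> T -> R) :
  (forall y z, Fmeas G (fun x => f x y z)) ->
  (forall x y y' (z z' : 'rV[R]_D), `|f x y z - f x y' z'| <=
     a0 x * `|y - y'| + \sum_(k < D) a k x * `|z ord0 k - z' ord0 k|) ->
  (forall x y y' (z z' : 'rV[R]_D) (l : R), 0 <= l <= 1 ->
     f x (l * y + (1 - l) * y') (l *: z + (1 - l) *: z')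
       <= l * f x y z + (1 - l) * f x y' z') ->
  Fmeas G u -> (forall k, Fmeas G (v k)) ->
  exists (r0 : T -> R) (r : 'I_D -> T -> R),
    [/\ Fmeas G r0, forall k, Fmeas G (r k),
       forall x, `|r0 x| <= a0 x, forall k x, `|r k x| <= a k x &
       forall x y (z : 'rV[R]_D),
         f x (u x) (\row_k v k x) + r0 x * (y - u x)
           + \sum_(k < D) r k x * (z ord0 k - v k x) <= f x y z].
Proof.
move=> mf fL fc mu mv.
pose V : lmodType R := (R^o * 'rV[R]_D)%type.
pose g x (p : V) := f x p.1 p.2.
pose p x : V := (u x, \row_k v k x).
have gc x : convex_fct (g x) by move=> w w' t t01; exact: fc.
pose h x := dir_deriv (g x) (p x).
have hs x : sublinear (h x) by exact: sublinear_dir_deriv.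
(* The base point [p x] moves with [x], so each quotient is measurable only through
   [Fmeas_caratheodory]. *)
have mh w : Fmeas G (h ^~ w).
  apply: (Fmeas_cvg G (fun m x => dir_quot (g x) (p x) w m)) => // [m|x]; last first.
    exact: dir_quot_cvg.
  have mg (w' : V) : Fmeas G (fun x => g x (p x + w')).
    have := Fmeas_caratheodory D f a0 a (fun x => u x + w'.1)
      (fun k x => v k x + w'.2 ord0 k) mf fL.
    rewrite (_ : (fun x => f x _ _) = (fun x => g x (p x + w'))); last first.
      apply/funext => x; rewrite /g/=; congr (f _ _ _).
      by apply/rowP => k; rewrite !mxE.
    by apply=> [|k]; apply: FmeasD => //; exact: Fmeas_cst.
  apply: FmeasM => //; first exact: Fmeas_cst.
  apply: FmeasB => //.
  by have := mg 0; under eq_fun do rewrite addr0.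
pose e0 : V := (1, 0); pose e (k : 'I_D) : V := (0, delta_mx ord0 k).
have [l [ls ml lh le]] := sublinear_minorant V h (e0 :: map e (enum 'I_D)) hs mh.
have lg x w : l x w <= g x (p x + w) - g x (p x).
  apply: le_trans (lh x w) _; have := dir_deriv_le (g x) (p x) w 1 (gc x) ltr01.
  by rewrite mul1r scale1r.
have le0 x : l x (- e0) = - l x e0 by apply: le; rewrite mem_head.
have lek x k : l x (- e k) = - l x (e k).
  by apply: le; rewrite in_cons map_f ?orbT// mem_enum.
have lZ x w (t : R) : l x (- w) = - l x w -> l x (t *: w) = t * l x w.
  move=> lN; have [t0|t0] := leP 0 t; first exact: (ls x).2.
  have := (ls x).2 (- t) (- w); rewrite oppr_ge0 => /(_ (ltW t0)).
  by rewrite lN scaleNr scalerN opprK mulrNN.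
have gL x w : `|g x (p x + w) - g x (p x)| <=
    a0 x * `|w.1| + \sum_(k < D) a k x * `|w.2 ord0 k|.
  have sK (s t : R) : s + t - s = t by rewrite addrC addKr.
  apply: le_trans (fL _ _ _ _ _) _ => /=; rewrite sK lerD2l.
  by apply: ler_sum => k _; rewrite !mxE sK.
have labs x w : l x (- w) = - l x w -> `|l x w| <=
    a0 x * `|w.1| + \sum_(k < D) a k x * `|w.2 ord0 k|.
  move=> lN; rewrite ler_norml lerNl -lN; apply/andP; split.
    apply: le_trans (lg _ _) _; apply: le_trans (ler_norm _) _.
    apply: le_trans (gL _ _) _ => /=; rewrite normrN lerD2l.
    by apply: ler_sum => k _; rewrite mxE normrN.
  apply: le_trans (lg _ _) _; apply: le_trans (ler_norm _) _; exact: gL.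
exists (l ^~ e0), (fun k => l ^~ (e k)); split => // [x|k x|x y z].
- apply: le_trans (labs _ _ (le0 x)) _.
  rewrite /= normr1 mulr1 big1 ?addr0// => k _.
  by rewrite mxE normr0 mulr0.
- apply: le_trans (labs _ _ (lek x k)) _.
  rewrite /= normr0 mulr0 add0r (bigD1 k)//= big1 => [|j jk].
    by rewrite mxE !eqxx normr1 mulr1 addr0.
  by rewrite mxE (negbTE jk) andbF normr0 mulr0.
pose w : V := (y - u x, \row_k (z ord0 k - v k x)).
have wE : w = w.1 *: e0 + \sum_(k < D) w.2 ord0 k *: e k.
  have -> : \sum_(k < D) w.2 ord0 k *: e k = (0, w.2) :> V.
    rewrite {2}(row_sum_delta w.2) (big_morph (fun z => (0, z) : V)
      (id1 := 0) (op1 := +%R)) => [|z1 z2|//].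
      by apply: eq_bigr => k _; congr (_, _); rewrite /= scaler0.
    by congr (_, _); rewrite addr0.
  congr (_, _); rewrite /= ?scaler0 ?add0r ?addr0//.
  by rewrite -[RHS]/((y - u x) * 1) mulr1.
have lsum (s : seq 'I_D) (c : 'I_D -> R) : 
    l x (\sum_(k <- s) c k *: e k) <= \sum_(k <- s) c k * l x (e k).
  elim: s => [|k s IH]; first by rewrite !big_nil -(scale0r (0:V)) (ls x).2// mul0r.
  by rewrite !big_cons (le_trans ((ls x).1 _ _))// lZ// lerD2l.
have := lg x w; rewrite /g -[f x y z]/(g x (y, z)).
have -> : p x + w = (y, z) :> V.
  rewrite /p /w; congr (_, _); first by rewrite addrC subrK.
  by apply/rowP => k; rewrite !mxE addrC subrK.
(* Subadditivity bounds [l x] at a combination of basis vectors only from above; used at [- w], it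
   yields the bound from below at [w]. *)
have lw : - l x w <= l x (- w).
  rewrite -subr_ge0 opprK (le_trans _ ((ls x).1 _ _))// addNr -(scale0r (0 : V)).
  by rewrite (ls x).2// mul0r.
have : l x (- w) <= - (w.1 * l x e0 + \sum_k w.2 ord0 k * l x (e k)).
  rewrite {1}wE opprD -!scaleNr -sumrN; under eq_bigr do rewrite -scaleNr.
  rewrite (le_trans ((ls x).1 _ _))// lZ// mulNr opprD lerD2l.
  by rewrite (le_trans (lsum _ _))// -sumrN; under eq_bigr do rewrite mulNr.
move=> H1 H2; have := le_trans lw H1; rewrite lerN2 => H3.
have := le_trans H3 H2; rewrite lerBrDl addrA [w.1 * _]mulrC.
by under eq_bigr do rewrite mxE mulrC.
Qed.

End MeasurableSubgradient.

(** * Almost everywhere comparison of integrals *)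

Section Integral.
Import HBSimple HBNNSimple.
Context {d : measure_display} {T : measurableType d} {R : realType}.

(* The integral of a nonnegative function is a supremum over simple functions,
   so monotonicity does not require measurability. *)
Lemma ae_le_integral (mu : {measure set T -> \bar R}) (A : set T)
    (f g : T -> \bar R) :
  (forall x, A x -> (0 <= f x)%E) -> (forall x, A x -> (0 <= g x)%E) ->
  {ae mu, forall x, A x -> (f x <= g x)%E} ->
  (\int[mu]_(x in A) f x <= \int[mu]_(x in A) g x)%E.
Proof.
move=> f0 g0 [N [mN muN fgN]]; rewrite !ge0_integralE//.
apply: ge_ereal_sup => _ [h /= hf <-].
(* Cutting [h] off on the null set keeps its integral and puts it below [g] at every point of
   [A]. *)
pose h' := mul_nnsfun h (indic_nnsfun R (measurableC mN)).
rewrite -integralT_nnsfun.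
have -> : (\int[mu]_x (h x)%:E = \int[mu]_x (h' x)%:E)%E.
  apply: ae_eq_integral => //.
  - exact/measurable_EFinP.
  - exact/measurable_EFinP.
  exists N; split => // x /= H; apply: contrapT => xN; apply: H => _.
  by rewrite /= mindicE mem_set// mulr1.
rewrite integralT_nnsfun; apply: ereal_sup_ubound; exists h' => //= x.
rewrite mindicE /patch; case: ifPn => [xA|xA].
  have [xN|xN] := boolP (x \in ~` N); last first.
    by rewrite mulr0; apply: g0; rewrite inE in xA.
  rewrite mulr1; apply: le_trans (hf x) _; rewrite /patch xA.
  rewrite inE /= in xN; apply: contrapT => H.
  by apply: xN; apply: fgN => /= fg; apply/H/fg; rewrite inE in xA.
have := hf x; rewrite /patch (negbTE xA) lee_fin => hx.
have -> : h x = 0 by apply/eqP; rewrite eq_le hx fun_ge0.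
by rewrite mul0r.
Qed.

(** This turns integral inequalities into almost sure ones: [A] is taken as the set where the
    desired inequality fails, [f] as the difference of its sides. *)
Lemma lt0_integral_ge0_null (mu : {measure set T -> \bar R}) (A : set T)
    (f : T -> \bar R) : measurable A -> mu.-integrable A f ->
  (forall x, A x -> f x < 0)%E -> (0 <= \int[mu]_(x in A) f x)%E -> mu A = 0%E.
Proof.
move=> mA fi f0 int0.
have mf := measurable_int _ fi.
have : (\int[mu]_(x in A) `|f x| = 0)%E.
  apply/eqP; rewrite eq_le; apply/andP; split; last exact: integral_ge0.
  rewrite (eq_integral (fun x => - f x)%E); last first.
    by move=> x; rewrite inE => /f0 fx; rewrite lte0_abs.
  by rewrite integralN ?oppe_le0//; exact: integrable_add_def.
move/ae_eq_integral_abs => /(_ mA mf) [N [mN N0 AN]].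
apply/eqP; rewrite eq_le measure_ge0 andbT -N0.
apply: le_measure; rewrite ?inE// => x Ax; apply: AN => /= /(_ Ax) fx.
by have := f0 x Ax; rewrite fx ltxx.
Qed.

End Integral.

(** * Weighting an inequality between integrals over the sets of [G] *)

Section ConditionallyNonneg.
Import HBSimple HBNNSimple.
Context {d : measure_display} {T : measurableType d} {R : realType}.
Variables (P : probability T R) (G : set (set T)).
Hypotheses (sG : sigma_algebra setT G) (GT : G `<=` measurable).

Lemma integral_nnsfun_mul (h : {nnsfun (g_sigma_algebraType G) >-> R}) (E : set T)
    (u : T -> R) : measurable E -> measurable_fun setT u ->
  (forall x, 0 <= u x) ->
  (\int[P]_(x in E) (h x * u x)%:E =
   \sum_(r \in range h) (r%:E * \int[P]_(x in E `&` h @^-1` [set r]) (u x)%:E))%E.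
Proof.
move=> mE mu u0.
pose I r : set T := h @^-1` [set r].
have mI r : measurable (I r) by rewrite /I; apply: GT; rewrite -measurable_g_sigma.
have hr r : range h r -> 0 <= r by move=> [x _ <-]; exact: fun_ge0.
have mIu r : measurable_fun E (fun x => \1_(I r) x * u x).
  by apply: measurable_funM => //; exact: measurable_funTS.
have hx x : h x = \sum_(r \in range h) r * \1_(I r) x by exact: fimfunE.
have ri0 r x : 0 <= r * \1_(I r) x.
  rewrite indicE; have [xI|] := boolP (x \in I r); last by rewrite mulr0.
  by rewrite mulr1; move: xI; rewrite inE => <-; exact: fun_ge0.
transitivity (\int[P]_(x in E)
    (\sum_(r \in range h) (r * (\1_(I r) x * u x))%:E))%E.
  apply: eq_integral => x xE; rewrite fsumEFin//; congr EFin.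
  by rewrite hx mulr_fsuml; apply: eq_fsbigr => r _; rewrite mulrA.
rewrite ge0_integral_fsum//; last 2 first.
- by move=> r; apply/measurable_EFinP; exact: measurable_funM.
- by move=> r x Ex; rewrite lee_fin mulrA mulr_ge0.
apply: eq_fsbigr => r /[!inE] /hr r0.
under eq_integral do rewrite EFinM.
rewrite ge0_integralZl//; last 2 first.
- exact/measurable_EFinP.
- by move=> t Et; rewrite lee_fin mulr_ge0.
congr (_ * _)%E; rewrite integral_mkcondr; apply: eq_integral => x _.
by rewrite /patch indicE; case: ifP => _; rewrite ?mul1r ?mul0r.
Qed.

(** Simple functions on [g_sigma_algebraType G] increase to [w]. Their level sets meet [A] in sets
    of [G], where the hypothesis applies, and monotone convergence gives the limit in [[0, +oo]]. *)
Lemma le_integral_weight (u v w : T -> R) :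
  measurable_fun setT u -> measurable_fun setT v ->
  (forall x, 0 <= u x) -> (forall x, 0 <= v x) ->
  (forall A, G A -> (\int[P]_(x in A) (u x)%:E <= \int[P]_(x in A) (v x)%:E)%E) ->
  Fmeas G w -> (forall x, 0 <= w x) ->
  forall A, G A ->
  (\int[P]_(x in A) (w x * u x)%:E <= \int[P]_(x in A) (w x * v x)%:E)%E.
Proof.
move=> mu mv u0 v0 uv mw w0 A GA.
have mA := GT _ GA.
have mw' : measurable_fun setT (EFin \o w : g_sigma_algebraType G -> \bar R).
  by apply/measurable_EFinP/FmeasP.
pose h := nnsfun_approx measurableT mw'.
have mh n : measurable_fun A (h n : T -> R).
  by apply/measurable_funTS/(Fmeas_measurable G) => //; apply/FmeasP.
have key (g : T -> R) : measurable_fun setT g -> (forall x, 0 <= g x) ->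
    (\int[P]_(x in A) (w x * g x)%:E =
     lim (\int[P]_(x in A) (h n x * g x)%:E @[n --> \oo]))%E /\
    cvgn (fun n => \int[P]_(x in A) (h n x * g x)%:E)%E.
  move=> mg g0.
  have mhg n : measurable_fun A (fun x => (h n x * g x)%:E).
    by apply/measurable_EFinP/measurable_funM => //; exact: measurable_funTS.
  have hg0 n x : A x -> (0 <= (h n x * g x)%:E)%E by rewrite lee_fin mulr_ge0.
  have hg_nd x : A x ->
      {homo (fun n => (h n x * g x)%:E) : m n / (m <= n)%N >-> (m <= n)%E}.
    move=> Ax m n mn; rewrite lee_fin ler_wpM2r//.
    by have /lefP := nd_nnsfun_approx measurableT mw' mn; exact.
  split; last exact: cvgP (cvg_monotone_convergence mA mhg hg0 hg_nd).
  rewrite -monotone_convergence//; apply: eq_integral => x _.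
  apply/esym/cvg_lim => //; apply/fine_cvgP; split; first exact: nearW.
  have /fine_cvgP[_ hw] : ((h n x)%:E @[n --> \oo] --> (w x)%:E)%E.
    apply: (cvg_nnsfun_approx measurableT mw' _ (x := x)) => // y _.
    by rewrite lee_fin.
  by apply: cvgMl; exact: hw.
have [-> cu] := key _ mu u0; have [-> cv] := key _ mv v0; apply: lee_lim => //.
apply: nearW => n; rewrite !integral_nnsfun_mul//.
apply: lee_fsum => // r [x _ <-].
apply: lee_wpmul2l; first by rewrite lee_fin.
apply: uv; rewrite -measurable_g_sigma//; apply: measurableI => //.
by rewrite measurable_g_sigma.
Qed.

End ConditionallyNonneg.

(** * Conditional nonnegativity and generalized conditional expectations *)

Section ConditionalExpectation.
Context {d : measure_display} {T : measurableType d} {R : realType}.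
Variable P : probability T R.
Implicit Types (G : set (set T)) (X Y V W C m w : T -> R).

Lemma integral_max0 (A : set T) X :
  (\int[P]_(x in A) (X x)%:E = \int[P]_(x in A) (Num.max (X x) 0)%:E
     - \int[P]_(x in A) (Num.max (- X x) 0)%:E)%E.
Proof.
rewrite integralE; congr (_ - _)%E; apply: eq_integral => x _.
  by rewrite funeposE EFin_max.
by rewrite funenegE EFin_max.
Qed.

Lemma measurable_max0 (A : set T) X : measurable_fun setT X ->
  measurable_fun A (fun x => (Num.max (X x) 0)%:E).
Proof.
move=> mX; apply/measurable_EFinP/measurable_funTS.
by apply: measurable_maxr => //; exact: measurable_cst.
Qed.

Lemma measurable_max0N (A : set T) X : measurable_fun setT X ->
  measurable_fun A (fun x => (Num.max (- X x) 0)%:E).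
Proof. by move=> mX; apply: measurable_max0; exact: measurableT_comp. Qed.

Lemma max0_ge0 (r : R) : (0 <= (Num.max r 0)%:E)%E.
Proof. by rewrite lee_fin le_max lexx orbT. Qed.

Lemma max0B (r : R) : Num.max r 0 - Num.max (- r) 0 = r.
Proof.
have [r0|/ltW r0] := leP 0 r.
  by rewrite max_r ?oppr_le0// subr0.
by rewrite max_l ?oppr_ge0// sub0r opprK.
Qed.

Lemma max0D (r : R) : Num.max r 0 + Num.max (- r) 0 = `|r|.
Proof.
have [r0|/ltW r0] := leP 0 r.
  by rewrite max_r ?oppr_le0// addr0 ger0_norm.
by rewrite max_l ?oppr_ge0// add0r ler0_norm.
Qed.

Lemma integrable_max0 (A : set T) X : measurable A -> measurable_fun setT X ->
  (\int[P]_(x in A) (Num.max (X x) 0)%:E < +oo)%E ->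
  (\int[P]_(x in A) (Num.max (- X x) 0)%:E < +oo)%E ->
  P.-integrable A (EFin \o X).
Proof.
move=> mA mX Xp Xn; apply/integrableP; split.
  by apply/measurable_EFinP; exact: measurable_funTS.
rewrite (eq_integral (fun x => (Num.max (X x) 0)%:E + (Num.max (- X x) 0)%:E)%E).
  rewrite ge0_integralD//; first exact: lte_add_pinfty.
  - by move=> x _; exact: max0_ge0.
  - exact: measurable_max0.
  - by move=> x _; exact: max0_ge0.
  - exact: measurable_max0N.
by move=> x _ /=; rewrite -EFinD max0D.
Qed.

Lemma integral_max0_lty (A : set T) X : measurable A ->
  P.-integrable A (EFin \o X) -> (\int[P]_(x in A) (Num.max (X x) 0)%:E < +oo)%E.
Proof.
move=> mA Xi; have := integrable_lty mA (integrable_funepos mA Xi).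
by congr (_ < _)%E; apply: eq_integral => x _; rewrite funeposE EFin_max.
Qed.

Lemma integral_max0N_lty (A : set T) X : measurable A ->
  P.-integrable A (EFin \o X) -> (\int[P]_(x in A) (Num.max (- X x) 0)%:E < +oo)%E.
Proof.
move=> mA Xi; apply: (integral_max0_lty A (fun x => - X x)) => //.
exact: (integrableN Xi).
Qed.

(* [E[X | G] >= 0] in the generalized sense, with [+oo - (+oo) := +oo]. *)
Definition cond_nonneg G X := measurable_fun setT X /\ forall A, G A ->
  (\int[P]_(x in A) (Num.max (- X x) 0)%:E
     <= \int[P]_(x in A) (Num.max (X x) 0)%:E)%E.

Lemma cond_nonneg_sub G H X : G `<=` H -> cond_nonneg H X -> cond_nonneg G X.
Proof. by move=> GH [mX hX]; split => // A /GH; exact: hX. Qed.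

Section Fixed.
Variable G : set (set T).
Hypotheses (sG : sigma_algebra setT G) (GT : G `<=` measurable).

Lemma cond_nonneg_ge0 X A : G A -> cond_nonneg G X ->
  P.-integrable A (EFin \o X) -> (0 <= \int[P]_(x in A) (X x)%:E)%E.
Proof.
move=> GA [mX hX] Xi; have mA := GT _ GA; rewrite integral_max0 sube_ge0 ?hX//.
rewrite ge0_fin_numE; first by rewrite integral_max0N_lty ?orbT.
by apply: integral_ge0 => x _; exact: max0_ge0.
Qed.

Lemma ge0_cond_nonneg X : P.-integrable setT (EFin \o X) ->
  (forall A, G A -> (0 <= \int[P]_(x in A) (X x)%:E)%E) -> cond_nonneg G X.
Proof.
move=> Xi X0; split; first exact/measurable_EFinP/(measurable_int _ Xi).
move=> A GA; have mA := GT _ GA; have := X0 A GA.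
rewrite integral_max0 sube_ge0// ge0_fin_numE; last first.
  by apply: integral_ge0 => x _; exact: max0_ge0.
by rewrite integral_max0N_lty ?orbT//; exact: integrableS Xi.
Qed.

(** The negative part is controlled by the positive part on [A]. This restores integrability
    locally, on sets of [G] where the positive part has finite integral. *)
Lemma cond_nonneg_integrable X A : G A -> cond_nonneg G X ->
  (\int[P]_(x in A) (Num.max (X x) 0)%:E < +oo)%E -> P.-integrable A (EFin \o X).
Proof.
move=> GA [mX hX] Xp; apply: integrable_max0 => //; first exact: GT.
exact: le_lt_trans (hX A GA) Xp.
Qed.

(** A nonnegative factor commutes with positive and negative parts, so the claim is a weighted
    comparison in [[0, +oo]], valid for unbounded [w]. *)
Lemma cond_nonnegM w X : Fmeas G w -> (forall x, 0 <= w x) ->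
  cond_nonneg G X -> cond_nonneg G (fun x => w x * X x).
Proof.
move=> mw w0 [mX hX]; split.
  by apply: measurable_funM => //; exact: Fmeas_measurable mw.
move=> A GA.
have wM r x : Num.max (w x * r) 0 = w x * Num.max r 0.
  by rewrite -[in LHS](mulr0 (w x)) maxr_pMr.
under eq_integral do rewrite -mulrN wM.
under [leRHS]eq_integral do rewrite wM.
apply: (le_integral_weight P G) => //.
- exact/measurable_EFinP/measurable_max0N.
- exact/measurable_EFinP/measurable_max0.
- by move=> x; rewrite -lee_fin; exact: max0_ge0.
- by move=> x; rewrite -lee_fin; exact: max0_ge0.
Qed.

(** If [(X + m)^+] has infinite integral over [A], the inequality is trivial. Otherwise
    [X^+ <= (X + m)^+ + m^-] makes [X] integrable on [A], and there the integrals can be added. *)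
Lemma cond_nonnegD X m : cond_nonneg G X -> P.-integrable setT (EFin \o m) ->
  cond_nonneg G m -> cond_nonneg G (fun x => X x + m x).
Proof.
move=> hX mi hm; have [mX _] := hX; have [mm _] := hm.
have mXm : measurable_fun setT (fun x => X x + m x) by exact: measurable_funD.
split => // A GA; have mA := GT _ GA.
have [->|] := eqVneq (\int[P]_(x in A) (Num.max (X x + m x) 0)%:E)%E +oo%E.
  exact: leey.
rewrite -ltey => Xmp.
have mAi : P.-integrable A (EFin \o m) by exact: integrableS mi.
have Xi : P.-integrable A (EFin \o X).
  apply: cond_nonneg_integrable => //.
  apply: (@le_lt_trans _ _ (\int[P]_(x in A)
      ((Num.max (X x + m x) 0)%:E + (Num.max (- m x) 0)%:E))%E).
    apply: ae_le_integral => [x _|x _|]; first exact: max0_ge0.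
      by rewrite adde_ge0// max0_ge0.
    apply: aeW => x _; rewrite -EFinD lee_fin.
    rewrite ge_max addr_ge0 ?le_max ?lexx ?orbT// andbT.
    by rewrite -[leLHS](addrK (m x)) lerD// le_max lexx.
  rewrite ge0_integralD//; last 4 first.
  - by move=> x _; exact: max0_ge0.
  - exact: measurable_max0.
  - by move=> x _; exact: max0_ge0.
  - exact: measurable_max0N.
  by rewrite lte_add_pinfty// integral_max0N_lty.
have Xmi : P.-integrable A (EFin \o (fun x => X x + m x)).
  exact: (integrableD mA Xi mAi).
have : (0 <= \int[P]_(x in A) (X x + m x)%:E)%E.
  rewrite (integralD mA Xi mAi) adde_ge0//; exact: cond_nonneg_ge0.
rewrite integral_max0 sube_ge0// ge0_fin_numE; last first.
  by apply: integral_ge0 => x _; exact: max0_ge0.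
by rewrite integral_max0N_lty ?orbT.
Qed.

Lemma integrable_dominated (A : set T) X Y : measurable A ->
  measurable_fun setT X -> P.-integrable A (EFin \o Y) ->
  (forall x, `|X x| <= `|Y x|) -> P.-integrable A (EFin \o X).
Proof.
move=> mA mX Yi XY; apply: le_integrable Yi => //.
  by apply/measurable_EFinP; exact: measurable_funTS.
by move=> x _; rewrite lee_fin.
Qed.

(** Both [X - C] and its negative are conditionally nonnegative. The weight has no sign, so
    [w (X - C)] is split as [w^+ (X - C) + w^- (C - X)], each with a nonnegative weight. *)
Lemma cond_nonneg_cexp_diff X C w : cexp P G X C -> Fmeas G w ->
  P.-integrable setT (EFin \o (fun x => w x * (X x - C x))) ->
  cond_nonneg G (fun x => w x * (X x - C x)).
Proof.
move=> [Xi [mC [Ci XC]]] mw wi.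
have XCi : P.-integrable setT (EFin \o (fun x => X x - C x)).
  exact: (integrableB measurableT Xi Ci).
have XC0 A : G A -> (\int[P]_(x in A) (X x - C x)%:E = 0)%E.
  move=> GA; have mA := GT _ GA.
  have XiA : P.-integrable A (EFin \o X) by exact: integrableS Xi.
  have CiA : P.-integrable A (EFin \o C) by exact: integrableS Ci.
  rewrite (integralB mA XiA CiA) /= XC// subee//.
  exact: integrable_fin_num XiA.
have mXC : measurable_fun setT (fun x => X x - C x).
  exact/measurable_EFinP/(measurable_int _ XCi).
have cp : cond_nonneg G (fun x => X x - C x).
  by apply: ge0_cond_nonneg => // A /XC0 ->.
have cn : cond_nonneg G (fun x => - (X x - C x)).
  apply: ge0_cond_nonneg => [|A GA]; first exact: (integrableN XCi).
  have mA := GT _ GA.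
  have XCiA : P.-integrable A (EFin \o (fun x => X x - C x)).
    exact: integrableS XCi.
  under eq_integral do rewrite EFinN.
  by rewrite integralN ?XC0 ?oppe0//; exact: integrable_add_def.
have mwT : measurable_fun setT w by exact: Fmeas_measurable mw.
have mwp : Fmeas G (fun x => Num.max (w x) 0).
  apply: (Fmeas_comp G w (fun r => Num.max r 0)) => //.
  by apply: measurable_maxr => //; exact: measurable_cst.
have mwn : Fmeas G (fun x => Num.max (- w x) 0).
  apply: (Fmeas_comp G w (fun r => Num.max (- r) 0)) => //.
  by apply: measurable_maxr => //; exact: measurable_cst.
have -> : (fun x => w x * (X x - C x)) = (fun x => Num.max (w x) 0 * (X x - C x)
    + Num.max (- w x) 0 * - (X x - C x)).
  apply/funext => x; by rewrite mulrN -mulrBl max0B.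
have g0 (r : R) : 0 <= Num.max r 0 by rewrite le_max lexx orbT.
apply: cond_nonnegD.
- exact: cond_nonnegM.
- apply: integrable_dominated wi _ => //.
    apply: measurable_funM; first exact: Fmeas_measurable mwn.
    exact: measurableT_comp.
  move=> x; rewrite !normrM normrN ler_wpM2r//.
  by rewrite ger0_norm// ge_max normr_ge0 andbT -normrN ler_norm.
- exact: cond_nonnegM.
Qed.

(** Conditional Jensen for the absolute value: with [s] the [G]-measurable sign of [C],
    [s (X - C) <= |X| - |C|], and the left side has nonnegative integral over the sets of [G]. *)
Lemma le_integral_abs_cexp X C w : cexp P G X C -> Fmeas G w ->
  (forall x, 0 <= w x) ->
  (\int[P]_x (w x * `|C x|)%:E <= \int[P]_x (w x * `|X x|)%:E)%E.
Proof.
move=> XC mw w0; have [Xi [mC [Ci _]]] := XC.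
have mX : measurable_fun setT X by exact/measurable_EFinP/(measurable_int _ Xi).
have mCT : measurable_fun setT C by exact: Fmeas_measurable mC.
have GTT : G setT by have [G0 GC _] := sG; rewrite -(setD0 setT); exact: GC.
apply: (le_integral_weight P G sG GT _ _ w) => //; try exact: measurableT_comp.
move=> A GA; have mA := GT _ GA.
pose s x : R := if 0 <= C x then 1 else -1.
have ms : Fmeas G s.
  apply: (Fmeas_comp G C (fun r => if 0 <= r then 1 else -1)) => //.
  by apply: measurable_fun_ifT => //; exact: measurable_fun_ler.
have s1 x : `|s x| = 1 by rewrite /s; case: ifP; rewrite ?normrN normr1.
have msT : measurable_fun setT s by exact: Fmeas_measurable ms.
have XCi : P.-integrable setT (EFin \o (fun x => X x - C x)).
  exact: (integrableB measurableT Xi Ci).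
have mXC : measurable_fun setT (fun x => X x - C x).
  exact/measurable_EFinP/(measurable_int _ XCi).
have si : P.-integrable setT (EFin \o (fun x => s x * (X x - C x))).
  apply: integrable_dominated XCi _ => //; first exact: measurable_funM.
  by move=> x; rewrite normrM s1 mul1r.
have s0 := cond_nonneg_ge0 _ A GA (cond_nonneg_cexp_diff X C s XC ms si)
  (integrableS measurableT mA (@subsetT _ _) si).
have aX : P.-integrable A (EFin \o (fun x => `|X x|)).
  apply: (integrable_dominated A _ X) => //; first exact: measurableT_comp.
    exact: integrableS Xi.
  by move=> x; rewrite normr_id.
have aC : P.-integrable A (EFin \o (fun x => `|C x|)).
  apply: (integrable_dominated A _ C) => //; first exact: measurableT_comp.
    exact: integrableS Ci.
  by move=> x; rewrite normr_id.
rewrite -sube_ge0; last by rewrite (integrable_fin_num mA aC).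
rewrite -(integralB mA aX aC); apply: le_trans s0 _.
apply: le_integral => //.
- exact: integrableS si.
- exact: (integrableB mA aX aC).
move=> x _; rewrite lee_fin mulrBr lerB//.
  by rewrite (le_trans (ler_norm _))// normrM s1 mul1r.
rewrite /s; case: ifPn => [C0|]; first by rewrite mul1r ger0_norm.
by rewrite -ltNge => C0; rewrite mulN1r ltr0_norm.
Qed.

Lemma cexp_unique X C C' : cexp P G X C -> cexp P G X C' ->
  {ae P, forall x, C x = C' x}.
Proof.
move=> [_ [mC [Ci XC]]] [_ [mC' [Ci' XC']]].
have half (C1 C2 : T -> R) : Fmeas G C1 -> Fmeas G C2 ->
    P.-integrable setT (EFin \o C1) -> P.-integrable setT (EFin \o C2) ->
    (forall A, G A -> \int[P]_(x in A) (C1 x)%:E = \int[P]_(x in A) (C2 x)%:E)%E ->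
    P.-negligible [set x | C1 x < C2 x].
  move=> m1 m2 i1 i2 e12; pose A := [set x | C1 x < C2 x].
  have GA : G A.
    rewrite (_ : A = (fun x => C1 x - C2 x) @^-1` [set` `]-oo, 0[ ]); last first.
      by apply/seteqP; split => x /=; rewrite in_itv/= subr_lt0.
    exact: (FmeasB G _ _ sG m1 m2).
  have mA := GT _ GA.
  have i1A : P.-integrable A (EFin \o C1) by exact: integrableS i1.
  have i2A : P.-integrable A (EFin \o C2) by exact: integrableS i2.
  apply/negligibleP => //.
  apply: (lt0_integral_ge0_null P A (EFin \o (fun x => C1 x - C2 x))) => //.
  - exact: (integrableB mA i1A i2A).
  - by move=> x /=; rewrite lte_fin subr_lt0.
  by rewrite (integralB mA i1A i2A) /= e12// subee//; exact: integrable_fin_num i2A.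
apply: (negligibleS _ (negligibleU (half C C' mC mC' Ci Ci' _)
  (half C' C mC' mC Ci' Ci _))) => [x /= /eqP|A GA|A GA].
- by rewrite neq_lt => /orP[]; [left|right].
- by rewrite XC// XC'.
- by rewrite XC// XC'.
Qed.

(** Formally [Y <= E[Y + L | G] <= E[X | G]]. On sets where [E[X^+ | G] < k] the positive part of
    [Y + L], and then [L], is integrable, which makes this chain an inequality of integrals. Where
    [Cp x] is [+oo], so is [C x] by convention. *)
Lemma gcexp_ge X Y L (C : T -> \bar R) : Fmeas G Y ->
  P.-integrable setT (EFin \o Y) -> cond_nonneg G L ->
  {ae P, forall x, Y x + L x <= X x} -> gcexp P G X C ->
  {ae P, forall x, ((Y x)%:E <= C x)%E}.
Proof.
move=> mY Yi hL XYL [Cp [Cn [[mCp [Cp0 eCp]] [[mCn [Cn0 eCn]] CE]]]].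
have [mL _] := hL.
have mYT : measurable_fun setT Y by exact: Fmeas_measurable mY.
have mCpT : measurable_fun setT Cp by exact: Fmeas_e_measurable mCp.
have mCnT : measurable_fun setT Cn by exact: Fmeas_e_measurable mCn.
pose V x := Y x + L x.
have mV : measurable_fun setT V by exact: measurable_funD.
(* Moving [Cn] to the right keeps the points with [Cn x = +oo] in [A k]; they are shown to be
   negligible together with the rest. *)
pose A k := [set x | (Cp x < k%:R%:E)%E] `&` [set x | (Cp x < (Y x)%:E + Cn x)%E].
suff A0 k : P.-negligible (A k).
  apply: negligibleS (negligible_bigcup A0) => x /= /negP; rewrite -ltNge CE.
  case: eqVneq => [_|]; first by rewrite ltNge leey.
  rewrite -ltey => Cpx CY.
  have Cpf : Cp x \is a fin_num by rewrite ge0_fin_numE.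
  exists (Num.truncn (fine (Cp x))).+1 => //; split => /=.
    by rewrite -[ltLHS]fineK// lte_fin truncnS_gt.
  move: CY; move: (Cn0 x); case: (Cn x) => [r| |] //.
    by rewrite lteBlDr.
have GA : G (A k).
  have [mCp' mCn'] := (iffLR (Fmeas_eP G Cp sG) mCp, iffLR (Fmeas_eP G Cn sG) mCn).
  have mY' := iffLR (FmeasP G Y sG) mY.
  rewrite -measurable_g_sigma//; apply: measurableI.
    rewrite -[X in measurable X]setTI; apply: measurable_lte => //.
  rewrite -[X in measurable X]setTI; apply: measurable_lte => //.
  by apply: emeasurable_funD => //; exact/measurable_EFinP.
have mA := GT _ GA.
have YiA : P.-integrable (A k) (EFin \o Y) by exact: integrableS Yi.
have ae_le (f g : T -> R) : (forall x, V x <= X x -> f x <= g x) ->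
    {ae P, forall x, A k x -> ((f x)%:E <= (g x)%:E)%E}.
  by move=> fg; apply: filterS XYL => x /fg ? _; rewrite lee_fin.
have VCp : (\int[P]_(x in A k) (Num.max (V x) 0)%:E <= \int[P]_(x in A k) Cp x)%E.
  rewrite eCp//; apply: ae_le_integral; try by move=> x _; exact: max0_ge0.
  by apply: ae_le => x VX; rewrite ge_max !le_max VX lexx orbT.
have CnV : (\int[P]_(x in A k) Cn x <= \int[P]_(x in A k) (Num.max (- V x) 0)%:E)%E.
  rewrite eCn//; apply: ae_le_integral; try by move=> x _; exact: max0_ge0.
  by apply: ae_le => x VX; rewrite ge_max !le_max lerN2 VX lexx orbT.
have Cpy : (\int[P]_(x in A k) Cp x < +oo)%E.
  apply: (@le_lt_trans _ _ (\int[P]_(x in A k) k%:R%:E)%E).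
    apply: ge0_le_integral => //; first exact: measurable_funTS.
    by move=> x [] /= /ltW.
  rewrite integral_cst//; apply: lte_mul_pinfty => //.
  by apply: le_lt_trans (probability_le1 P mA) _; rewrite ltey.
have Li : P.-integrable (A k) (EFin \o L).
  apply: (cond_nonneg_integrable L) => //.
  apply: (@le_lt_trans _ _ (\int[P]_(x in A k)
      ((Num.max (V x) 0)%:E + (Num.max (- Y x) 0)%:E))%E).
    apply: ae_le_integral => [x _|x _|]; first exact: max0_ge0.
      by rewrite adde_ge0// max0_ge0.
    apply: aeW => x _; rewrite -EFinD lee_fin.
    rewrite ge_max addr_ge0 ?le_max ?lexx ?orbT// andbT.
    by rewrite -[leLHS](addKr (Y x)) addrC lerD// le_max lexx.
  rewrite ge0_integralD//; last 4 first.
  - by move=> x _; exact: max0_ge0.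
  - exact: measurable_max0.
  - by move=> x _; exact: max0_ge0.
  - exact: measurable_max0N.
  rewrite lte_add_pinfty// ?integral_max0N_lty//.
  exact: le_lt_trans VCp Cpy.
have Vi : P.-integrable (A k) (EFin \o V) by exact: (integrableD mA YiA Li).
have Cny : (\int[P]_(x in A k) Cn x < +oo)%E.
  by apply: le_lt_trans CnV _; exact: integral_max0N_lty.
have Cpi : P.-integrable (A k) Cp.
  apply/integrableP; split; first exact: measurable_funTS.
  by under eq_integral do rewrite gee0_abs//.
have Cni : P.-integrable (A k) Cn.
  apply/integrableP; split; first exact: measurable_funTS.
  by under eq_integral do rewrite gee0_abs//.
apply/negligibleP => //.
apply: (lt0_integral_ge0_null P (A k) (fun x => Cp x - Cn x - (Y x)%:E)%E) => //.
- by apply: integrableB => //; exact: integrableB.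
- move=> x [/= Ck CY]; have : (Cp x < +oo)%E by exact: lt_trans Ck (ltey _).
  move: (Cn0 x) (Cp0 x) CY.
  case: (Cn x) => [r| |]; case: (Cp x) => [s| |] //= _ _.
  by rewrite !lte_fin; lra.
rewrite (integralB mA (integrableB mA Cpi Cni) YiA) (integralB mA Cpi Cni).
have : (\int[P]_(x in A k) (Y x)%:E <= \int[P]_(x in A k) (V x)%:E)%E.
  by rewrite (integralD mA YiA Li) leeDl// cond_nonneg_ge0.
rewrite sube_ge0; last by rewrite (integrable_fin_num mA YiA).
by move=> /le_trans; apply; rewrite integral_max0 leeB.
Qed.

(** [X] itself may fail to be measurable, so the integrals of its parts are identified by almost
    everywhere monotonicity in both directions. *)
Lemma gcexp_ae_eq X Y : Fmeas G Y -> P.-integrable setT (EFin \o Y) ->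
  {ae P, forall x, X x = Y x} -> gcexp P G X (EFin \o Y).
Proof.
move=> mY Yi XY.
exists (fun x => (Num.max (Y x) 0)%:E), (fun x => (Num.max (- Y x) 0)%:E).
have H (g : R -> R) : measurable_fun setT g -> (forall r, 0 <= g r) ->
    cexp_nn P G (fun x => (g (X x))%:E) (fun x => (g (Y x))%:E).
  move=> mg g0; split; last split.
  - apply/Fmeas_eP => //; apply/measurable_EFinP/FmeasP => //.
    exact: (Fmeas_comp G Y g).
  - by move=> x; rewrite lee_fin.
  move=> A GA; apply/eqP; rewrite eq_le; apply/andP; split.
    apply: ae_le_integral => [x _|x _|]; rewrite ?lee_fin//.
    by apply: filterS XY => x ->.
  apply: ae_le_integral => [x _|x _|]; rewrite ?lee_fin//.
  by apply: filterS XY => x ->.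
have g0 (r : R) : 0 <= Num.max r 0 by rewrite le_max lexx orbT.
have mm : measurable_fun setT (fun r : R => Num.max r 0).
  by apply: measurable_maxr => //; exact: measurable_cst.
split; first exact: (H (fun r => Num.max r 0)).
split.
  apply: (H (fun r => Num.max (- r) 0)) => //.
  by apply: measurable_maxr => //; exact: measurable_cst.
by move=> x /=; rewrite -EFinB max0B.
Qed.

End Fixed.
End ConditionalExpectation.

(** * The implicit equation [t = max(s, g t)] *)

Section FixedPoint.
Context {R : realType}.
Implicit Types (s : \bar R) (g : R -> R) (q : R).

(** A maximum with a constant does not increase distances; for [s = -oo] the real-valued replacement
    is [g] itself. *)
Lemma max_lipschitz s g q : s != +oo%E ->
  (forall t t', `|g t - g t'| <= q * `|t - t'|) ->
  exists h : R -> R, (forall t, (h t)%:E = Order.max s (g t)%:E) /\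
    (forall t t', `|h t - h t'| <= q * `|t - t'|).
Proof.
case: s => [r _ gq| //|_ gq]; last by exists g; split => // t; rewrite maxNye.
exists (fun t => Num.max r (g t)); split=> [t|t t']; first by rewrite EFin_max.
apply: le_trans (gq t t'); rewrite ler_norml.
have := ler_norm (g t - g t'); have := ler_norm (- (g t - g t')); rewrite normrN.
have := normr_ge0 (g t - g t').
by have [?|?] := leP r (g t); have [?|?] := leP r (g t') => *; apply/andP; split; lra.
Qed.

Lemma max_fixpoint s g q : s != +oo%E -> q < 1 ->
  (forall t t', `|g t - g t'| <= q * `|t - t'|) ->
  exists t : R, t%:E = Order.max s (g t)%:E.
Proof.
move=> sy q1 /(max_lipschitz s g q sy)[h [hE hq]].
have q0 : 0 <= q by have := le_trans (normr_ge0 _) (hq 1 0); rewrite subr0 normr1 mulr1.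
(* [B] solves [B = |h 0| + q B], so [|h|] is at most [B] at both ends of [[-B, B]] and [k] changes
   sign there. *)
pose B := `|h 0| / (1 - q); pose k t := t - h t.
have q1' : 0 < 1 - q by rewrite subr_gt0.
have B0 : 0 <= B by rewrite divr_ge0// ltW.
have BE : B * (1 - q) = `|h 0| by rewrite divfK// gt_eqF.
have ck : continuous k.
  move=> t; apply/cvgrPdist_le => e e0; near=> u.
  have tu : `|t - u| <= e / 2.
    near: u; apply: (@cvgr_dist_le _ _ _ _ _ id t) => //; exact: divr_gt0.
  have -> : k t - k u = (t - u) - (h t - h u) by rewrite /k; ring.
  rewrite (le_trans (ler_normB _ _))//; have := hq t u.
  by have := normr_ge0 (t - u); nra.
have [|||c _ kc] := @IVT R k (- B) B 0.
- by lra.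
- exact: continuous_subspaceT.
- have HB (b : R) : `|b| = B -> - (q * B) <= h b - h 0 <= q * B.
    by move=> bB; have := hq b 0; rewrite subr0 bB ler_norml.
  have /andP[H1 H2] : - (q * B) <= h B - h 0 <= q * B by apply/HB/ger0_norm.
  have /andP[H3 H4] : - (q * B) <= h (- B) - h 0 <= q * B.
    by apply: HB; rewrite normrN ger0_norm.
  have := ler_norm (h 0); have := ler_norm (- h 0); rewrite normrN => H5 H6.
  rewrite /k ge_min le_max; apply/andP; split; apply/orP; [left|right]; nra.
by exists c; rewrite -hE; congr EFin; apply/eqP; rewrite -subr_eq0; apply/eqP.
Unshelve. all: end_near.
Qed.

Lemma max_fixpoint_unique s g q (t t' : R) : s != +oo%E -> q < 1 ->
  (forall t t', `|g t - g t'| <= q * `|t - t'|) ->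
  t%:E = Order.max s (g t)%:E -> t'%:E = Order.max s (g t')%:E -> t = t'.
Proof.
move=> sy q1 /(max_lipschitz s g q sy)[h [hE hq]].
rewrite -!hE => -[tE] [tE']; have := hq t t'; rewrite -tE -tE' => H.
apply/eqP; rewrite -subr_eq0 -normr_eq0; have := normr_ge0 (t - t').
by rewrite le_eqVlt eq_sym => /orP[//|H0]; nra.
Qed.

End FixedPoint.

(** * One backward step of the pathwise recursion *)

Section ThetaStep.
Context {d : measure_display} {T : measurableType d} {R : realType} {D : nat}.
Variables (S : nat -> T -> \bar R) (f : nat -> T -> R -> 'rV[R]_D -> R).
Variables (alpha0 : nat -> T -> R) (alpha : 'I_D -> nat -> T -> R).
Variables (beta : 'I_D -> nat -> T -> R) (Delta : nat -> R).
Variables (M0 : nat -> T -> R) (M : 'I_D -> nat -> T -> R).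
Variables (i : nat) (x : T) (next : R).
Hypotheses (Delta0 : 0 < Delta i) (Sy : S i x != +oo%E).
Hypothesis alpha0_lt : alpha0 i x < (Delta i)^-1.
Hypothesis fL : forall y y' (z z' : 'rV[R]_D), `|f i x y z - f i x y' z'|
  <= alpha0 i x * `|y - y'| + \sum_(k < D) alpha k i x * `|z ord0 k - z' ord0 k|.

Let step t := next - (M0 i.+1 x - M0 i x)
  + f i x t (\row_(k < D) (beta k i.+1 x * next - (M k i.+1 x - M k i x)))
    * Delta i.

Let alphaD_lt1 : alpha0 i x * Delta i < 1.
Proof. by rewrite -ltr_pdivlMr// div1r. Qed.

Let step_lipschitz t t' :
  `|step t - step t'| <= alpha0 i x * Delta i * `|t - t'|.
Proof.
pose z : 'rV[R]_D := \row_(k < D) (beta k i.+1 x * next - (M k i.+1 x - M k i x)).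
have -> : step t - step t' = (f i x t z - f i x t' z) * Delta i.
  by rewrite /step -/z; ring.
rewrite normrM [`|Delta i|]gtr0_norm//.
rewrite mulrAC ler_pM2r//; apply: le_trans (fL _ _ _ _) _.
by rewrite [X in _ + X]big1 ?addr0// => k _; rewrite subrr normr0 mulr0.
Qed.

(** In its implicit argument the step is Lipschitz with constant [alpha0 i x * Delta i < 1]; a
    solution exists, and [xget] does not return its default. *)
Lemma theta_stepE :
  (theta_step S f alpha0 beta Delta M0 M i x next)%:E =
  Order.max (S i x) ((next - (M0 i.+1 x - M0 i x)
    + f i x (theta_step S f alpha0 beta Delta M0 M i x next)
        (\row_(k < D) (beta k i.+1 x * next - (M k i.+1 x - M k i x)))
      * Delta i)%:E).
Proof.
rewrite /theta_step alphaD_lt1.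
have := max_fixpoint _ _ _ Sy alphaD_lt1 step_lipschitz; rewrite /step => -[t tE].
exact: (xgetPex 0 (ex_intro (fun t : R => t%:E = Order.max (S i x) _) t tE)).
Qed.

Lemma theta_step_unique (t : R) :
  t%:E = Order.max (S i x) ((next - (M0 i.+1 x - M0 i x)
    + f i x t (\row_(k < D) (beta k i.+1 x * next - (M k i.+1 x - M k i x)))
      * Delta i)%:E) ->
  theta_step S f alpha0 beta Delta M0 M i x next = t.
Proof.
exact: (max_fixpoint_unique _ _ _ _ _ Sy alphaD_lt1 step_lipschitz theta_stepE).
Qed.

End ThetaStep.

(** * Integrability of weighted martingale differences *)

Section Integrability.
Context {d : measure_display} {T : measurableType d} {R : realType}.
Variables (P : probability T R) (G : set (set T)).
Hypotheses (sG : sigma_algebra setT G) (GT : G `<=` measurable).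

(** The weight [a] may be unbounded, only [a |b|] is controlled. This dominates [a b Y] by
    [|c| |Y|], and the weighted conditional Jensen inequality transfers the bound to [a C]. *)
Lemma integrable_weighted_cexp (a b Y C : T -> R) (c : R) :
  Fmeas G a -> (forall x, 0 <= a x) -> P.-integrable setT (EFin \o Y) ->
  {ae P, forall x, a x * `|b x| <= c} ->
  cexp P G (fun x => b x * Y x) C ->
  P.-integrable setT (EFin \o (fun x => a x * (b x * Y x - C x))).
Proof.
move=> ma a0 Yi abc bYC; have [bYi [mC [Ci _]]] := bYC.
have maT : measurable_fun setT a by exact: Fmeas_measurable ma.
have mbY : measurable_fun setT (fun x => b x * Y x).
  exact/measurable_EFinP/(measurable_int _ bYi).
have mCT : measurable_fun setT C by exact: Fmeas_measurable mC.
have mn (X : T -> R) : measurable_fun setT X ->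
    measurable_fun setT (fun x => (a x * `|X x|)%:E).
  move=> mX; apply/measurable_EFinP; apply: measurable_funM => //.
  exact: measurableT_comp.
have an0 (r : R) x : (0 <= (a x * `|r|)%:E)%E by rewrite lee_fin mulr_ge0.
have bYlty : (\int[P]_x (a x * `|b x * Y x|)%:E < +oo)%E.
  have cYi : P.-integrable setT (EFin \o (fun x => `|c| * `|Y x|)).
    exact: (integrableZl measurableT `|c| (integrable_abse Yi)).
  apply: le_lt_trans (integrable_lty measurableT cYi).
  apply: ae_ge0_le_integral => //.
  - exact: mn.
  - by move=> x _; rewrite lee_fin mulr_ge0.
  - exact/(measurable_int _ cYi).
  apply: filterS abc => x H _; rewrite lee_fin normrM mulrA ler_wpM2r//.
  exact: le_trans H (ler_norm _).
apply/integrableP; split.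
  by apply/measurable_EFinP; apply: measurable_funM => //; exact: measurable_funB.
apply: (@le_lt_trans _ _ (\int[P]_x
   ((a x * `|b x * Y x|)%:E + (a x * `|C x|)%:E))%E).
  apply: ge0_le_integral => //.
  - apply/measurableT_comp => //; apply/measurable_EFinP.
    by apply: measurable_funM => //; exact: measurable_funB.
  - by apply: emeasurable_funD; exact: mn.
  move=> x _; rewrite -EFinD lee_fin normrM ger0_norm// -mulrDr.
  by rewrite ler_wpM2l// ler_normB.
rewrite ge0_integralD//; [|exact: mn|exact: mn].
rewrite lte_add_pinfty//; apply: le_lt_trans bYlty.
exact: (le_integral_abs_cexp P G).
Qed.

Lemma integrable_weight (a X : T -> R) : measurable_fun setT a ->
  (forall x, 0 <= a x) -> measurable_fun setT X ->
  (\int[P]_x (a x * `|X x|)%:E < +oo)%E ->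
  P.-integrable setT (EFin \o (fun x => a x * X x)).
Proof.
move=> ma a0 mX aX; apply/integrableP; split.
  by apply/measurable_EFinP; exact: measurable_funM.
apply: le_lt_trans aX; rewrite le_eqVlt; apply/orP; left; apply/eqP.
by apply: eq_integral => x _ /=; rewrite normrM ger0_norm.
Qed.

End Integrability.

(** * One backward step of the lower bound *)

Section LowerStep.
Context {d : measure_display} {T : measurableType d} {R : realType} {D : nat}.
Variables (P : probability T R) (G H : set (set T)).
Hypotheses (sG : sigma_algebra setT G) (sH : sigma_algebra setT H).
Hypotheses (GH : G `<=` H) (HT : H `<=` measurable).

Definition integrable_cond_nonneg (m : T -> R) :=
  P.-integrable setT (EFin \o m) /\ cond_nonneg P G m.

Let GT : G `<=` measurable. Proof. exact: subset_trans HT. Qed.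

Lemma integrable_cond_nonnegD (m m' : T -> R) :
  integrable_cond_nonneg m -> integrable_cond_nonneg m' ->
  integrable_cond_nonneg (fun x => m x + m' x).
Proof.
move=> [mi cm] [mi' cm']; split; first exact: (integrableD measurableT mi mi').
exact: cond_nonnegD.
Qed.

Lemma integrable_cond_nonneg_cexp (w X C : T -> R) : cexp P G X C -> Fmeas G w ->
  P.-integrable setT (EFin \o (fun x => w x * (X x - C x))) ->
  integrable_cond_nonneg (fun x => w x * (X x - C x)).
Proof. by move=> XC mw wi; split => //; exact: cond_nonneg_cexp_diff. Qed.

(** Meant for [w] equal, up to sign, to [dt] times a subgradient coordinate, which is dominated by
    [dt] times its Lipschitz coefficient [a]. *)
Lemma integrable_cond_nonneg_weight (a w X C : T -> R) (c : R) : cexp P G X C ->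
  Fmeas G w -> (forall x, `|w x| <= c * a x) ->
  P.-integrable setT (EFin \o (fun x => a x * (X x - C x))) ->
  integrable_cond_nonneg (fun x => w x * (X x - C x)).
Proof.
move=> XC mw wa ai; apply: integrable_cond_nonneg_cexp => //.
have [Xi [mC [Ci _]]] := XC.
have mXC : measurable_fun setT (fun x => X x - C x).
  exact/measurable_EFinP/(measurable_int _ (integrableB measurableT Xi Ci)).
apply: (integrable_dominated P setT _ (fun x => c * (a x * (X x - C x)))) => //.
- by apply: measurable_funM => //; exact: Fmeas_measurable mw.
- exact: (integrableZl measurableT c ai).
move=> x; rewrite mulrA normrM [leRHS]normrM ler_wpM2r//.
exact: le_trans (wa x) (ler_norm _).
Qed.

Lemma integrable_cond_nonneg_sum (I : finType) (m : I -> T -> R) :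
  (forall k, integrable_cond_nonneg (m k)) ->
  integrable_cond_nonneg (fun x => \sum_k m k x).
Proof.
move=> mm; elim: (index_enum I) => [|k s IH].
  under eq_fun do rewrite big_nil.
  have i0 : P.-integrable setT (EFin \o (fun=> 0 : R)) by exact: integrable0.
  by split => //; apply: ge0_cond_nonneg => // A _; exact: integral_ge0.
by under eq_fun do rewrite big_cons; exact: integrable_cond_nonnegD.
Qed.

(** [th0] and [th1] are quantified inside the almost sure statement: the exceptional set does not
    depend on them, and a pathwise solution without known measurability can be inserted. *)
Lemma theta_lower_step (f : T -> R -> 'rV[R]_D -> R) (a0 : T -> R)
    (a b : 'I_D -> T -> R) (dt : R) (S : T -> \bar R) (Y0 Y1 C : T -> R)
    (Z : 'I_D -> T -> R) (N0 N0' : T -> R) (N N' : 'I_D -> T -> R) (L1 : T -> R) :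
  0 < dt -> Fmeas_e G S ->
  (forall y z, Fmeas G (fun x => f x y z)) ->
  (forall x y y' (z z' : 'rV[R]_D), `|f x y z - f x y' z'| <=
     a0 x * `|y - y'| + \sum_(k < D) a k x * `|z ord0 k - z' ord0 k|) ->
  (forall x y y' (z z' : 'rV[R]_D) (l : R), 0 <= l <= 1 ->
     f x (l * y + (1 - l) * y') (l *: z + (1 - l) *: z')
       <= l * f x y z + (1 - l) * f x y' z') ->
  (forall k, Fmeas G (a k)) -> (forall k x, 0 <= a k x) ->
  (forall k, Fmeas H (b k)) ->
  {ae P, forall x, a0 x < dt^-1} ->
  {ae P, forall x, \sum_(k < D) a k x * `|b k x| <= dt^-1} ->
  Fmeas G Y0 -> P.-integrable setT (EFin \o Y1) ->
  cexp P G Y1 C -> (forall k, cexp P G (fun x => b k x * Y1 x) (Z k)) ->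
  {ae P, forall x, (Y0 x)%:E =
     Order.max (S x) (C x + f x (Y0 x) (\row_(k < D) Z k x) * dt)%:E} ->
  cexp P G N0' N0 -> (forall k, cexp P G (N' k) (N k)) ->
  (forall k, (\int[P]_x (a k x * `|N' k x - N k x|)%:E < +oo)%E) ->
  cond_nonneg P H L1 ->
  exists2 L0 : T -> R, cond_nonneg P G L0 &
    {ae P, forall x, forall th0 th1, Y1 x + L1 x <= th1 ->
       th0%:E = Order.max (S x) ((th1 - (N0' x - N0 x)
         + f x th0 (\row_(k < D) (b k x * th1 - (N' k x - N k x))) * dt)%:E) ->
       Y0 x + L0 x <= th0}.
Proof.
move=> dt0 mS mf fL fc ma a_ge0 mb a0dt abdt mY0 Y1i Y1C Y1Z Y0E N0E NE aN hL1.
have mZ k : Fmeas G (Z k) by have [_ []] := Y1Z k.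
have [r0 [r [mr0 mr r0a ra subg]]] :=
  measurable_subgradient G sG D f a0 a Y0 Z mf fL fc mY0 mZ.
have abk k : {ae P, forall x, a k x * `|b k x| <= dt^-1}.
  apply: filterS abdt => x; apply: le_trans.
  by rewrite (bigD1 k)//= lerDl sumr_ge0// => j _; rewrite mulr_ge0.
have mcst (c : R) : Fmeas G (fun=> c) by exact: Fmeas_cst.
(* What remains of the linearized step once [th1 - Y1] has been factored out with coefficient
   [c]. *)
pose m x := 1 * (Y1 x - C x) + (- 1) * (N0' x - N0 x)
  + (\sum_(k < D) (dt * r k x) * (b k x * Y1 x - Z k x)
  + \sum_(k < D) (- dt * r k x) * (N' k x - N k x)).
have int1 X X' (c : R) : cexp P G X X' ->
    P.-integrable setT (EFin \o (fun x => c * (X x - X' x))).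
  move=> [Xi [_ [Xi' _]]].
  exact: (integrableZl measurableT c (integrableB measurableT Xi Xi')).
have mmart : integrable_cond_nonneg m.
  apply: integrable_cond_nonnegD; apply: integrable_cond_nonnegD.
  - by apply: integrable_cond_nonneg_cexp => //; exact: int1.
  - by apply: integrable_cond_nonneg_cexp => //; exact: int1.
  - apply: integrable_cond_nonneg_sum => k.
    apply: (integrable_cond_nonneg_weight (a k) _ _ _ dt) => //.
    + exact: FmeasM.
    + by move=> x; rewrite normrM (gtr0_norm dt0) ler_pM2l.
    + exact: (integrable_weighted_cexp P G sG GT _ _ _ _ dt^-1).
  - apply: integrable_cond_nonneg_sum => k.
    apply: (integrable_cond_nonneg_weight (a k) _ _ _ dt) => //.
    + exact: FmeasM.
    + by move=> x; rewrite normrM normrN (gtr0_norm dt0) ler_pM2l.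
    + have [Ni [mN _]] := NE k.
      apply: integrable_weight => //.
      * exact: Fmeas_measurable (ma k).
      * apply: measurable_funB; last exact: Fmeas_measurable mN.
        exact/measurable_EFinP/(measurable_int _ Ni).
pose B := [set x | (S x < (Y0 x)%:E)%E].
have GB : G B.
  have mS' := iffLR (Fmeas_eP G S sG) mS; have mY' := iffLR (FmeasP G Y0 sG) mY0.
  rewrite -measurable_g_sigma// -[X in measurable X]setTI.
  by apply: measurable_lte => //; exact/measurable_EFinP.
(* Almost surely [1 - r0 x * dt > 0], since [|r0| <= a0 < dt^-1], and the power is its inverse. No
   distance from 0 is assumed, which is why [w] may be unbounded. *)
pose w x := \1_B x * (Num.max (1 - r0 x * dt) 0) `^ (-1).
have mw : Fmeas G w.
  apply: FmeasM => //.
    apply/FmeasP => //; apply: measurable_indic.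
    by rewrite measurable_g_sigma.
  apply: (Fmeas_comp G (fun x => Num.max (1 - r0 x * dt) 0) (fun t => t `^ (-1))).
    exact: measurable_powR.
  apply: (Fmeas_comp G (fun x => 1 - r0 x * dt) (fun t => Num.max t 0)).
    by apply: measurable_maxr => //; exact: measurable_cst.
  by apply: FmeasB => //; exact: FmeasM.
have w0 x : 0 <= w x by rewrite mulr_ge0// powR_ge0.
(* Truncation gives a sign at every point, as [cond_nonnegM] asks; [cE] below shows that almost
   surely it changes nothing. As [b] is only [H]-measurable, this weight is applied before passing
   from [H] to [G]. *)
pose c x := Num.max (1 + \sum_(k < D) dt * (r k x * b k x)) 0.
have mc : Fmeas H c.
  apply: (Fmeas_comp H (fun x => 1 + \sum_(k < D) dt * (r k x * b k x))
    (fun t => Num.max t 0)).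
    by apply: measurable_maxr => //; exact: measurable_cst.
  apply: FmeasD => //; first exact: Fmeas_cst.
  apply: Fmeas_sum => // k; apply: FmeasM => //; first exact: Fmeas_cst.
  apply: FmeasM => //; exact: Fmeas_sub (mr k).
have c0 x : 0 <= c x by rewrite le_max lexx orbT.
exists (fun x => w x * (c x * L1 x + m x)).
  apply: cond_nonnegM => //; apply: cond_nonnegD => //; [|exact: mmart.1|exact: mmart.2].
  exact/(cond_nonneg_sub P G H)/cond_nonnegM.
near=> x => th0 th1 Lth1 th0E.
have ax : a0 x < dt^-1 by near: x.
have abx : \sum_(k < D) a k x * `|b k x| <= dt^-1 by near: x.
have Yx : (Y0 x)%:E = Order.max (S x) (C x + f x (Y0 x) (\row_(k < D) Z k x) * dt)%:E.
  by near: x.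
have [SY|SY] := ltP (S x) (Y0 x)%:E; last first.
  rewrite /w indicE memNset; last by rewrite /B /= ltNge SY.
  rewrite !mul0r addr0 -lee_fin (le_trans SY)// th0E le_max lexx//.
have {}Yx : Y0 x = C x + f x (Y0 x) (\row_(k < D) Z k x) * dt.
  move: Yx; rewrite /Order.max; case: ifP => _ [] // Yx.
  by move: SY; rewrite Yx ltxx.
have th0_ge : th1 - (N0' x - N0 x)
    + f x th0 (\row_(k < D) (b k x * th1 - (N' k x - N k x))) * dt <= th0.
  by rewrite -lee_fin th0E le_max lexx orbT.
have q0 : 0 < 1 - r0 x * dt.
  rewrite subr_gt0 -ltr_pdivlMr// div1r; apply: le_lt_trans ax.
  exact: le_trans (ler_norm _) (r0a x).
have cE : c x = 1 + \sum_(k < D) dt * (r k x * b k x).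
  rewrite /c max_l// -lerBlDl sub0r lerNl -sumrN -(divff (lt0r_neq0 dt0)).
  apply: le_trans (ler_wpM2l (ltW dt0) abx); rewrite mulr_sumr.
  apply: ler_sum => k _; rewrite -mulrN ler_pM2l// (le_trans (ler_norm _))//.
  by rewrite normrN normrM ler_wpM2r.
rewrite /w indicE mem_set// mul1r (max_l (ltW q0)) (powR_inv1 (ltW q0)).
rewrite -lerBrDl ler_pdivrMl//.
have := ler_wpM2r (ltW dt0)
  (subg x th0 (\row_(k < D) (b k x * th1 - (N' k x - N k x)))).
have sumE : (\sum_(k < D) r k x * ((\row_(k < D) (b k x * th1 - (N' k x - N k x)))
      ord0 k - Z k x)) * dt =
    (\sum_(k < D) dt * (r k x * b k x)) * (th1 - Y1 x)
    + (\sum_(k < D) (dt * r k x) * (b k x * Y1 x - Z k x)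
      + \sum_(k < D) (- dt * r k x) * (N' k x - N k x)).
  rewrite !mulr_suml -!big_split; apply: eq_bigr => k _ /=; rewrite mxE; ring.
have cL : c x * L1 x <= c x * (th1 - Y1 x) by rewrite ler_wpM2l// lerBrDl.
move: cL; rewrite {2}cE mulrDl mul1r mulrDl [X in X + _ <= _]mulrDl sumE /m; lra.
Unshelve. all: end_near.
Qed.

End LowerStep.

(** * Doob martingales *)

Section Doob.
Context {d : measure_display} {T : measurableType d} {R : realType}.
Variables (P : probability T R) (n : nat) (F : nat -> set (set T)).
Hypothesis hF : filtration n F.

(** Measurability of [X] is asked from index 1 on, which matches [beta], adapted at times 1 to
    [n]. *)
Lemma doob_martingale (X C : nat -> T -> R) :
  (forall j, (j < n)%N -> Fmeas (F j.+1) (X j.+1)) ->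
  (forall j, (j < n)%N -> cexp P (F j) (X j.+1) (C j)) ->
  is_mart P n F (fun i x => \sum_(j < i) (X j.+1 x - C j x)).
Proof.
move=> mX XC; have [sF [FT Fle]] := hF.
pose M i x := \sum_(j < i) (X j.+1 x - C j x).
have MS i : M i.+1 = (fun x => M i x + (X i.+1 x - C i x)).
  by apply/funext => x; rewrite /M big_ord_recr.
have XCi i : (i < n)%N ->
    P.-integrable setT (EFin \o (fun x => X i.+1 x - C i x)).
  by move=> /XC[Xi [_ [Ci _]]]; exact: (integrableB measurableT Xi Ci).
have [mM Mi] : (forall i, (i <= n)%N -> Fmeas (F i) (M i)) /\
    (forall i, (i <= n)%N -> P.-integrable setT (EFin \o M i)).
  split=> i; elim: i => [_|i IH ni].
  - rewrite (_ : M 0%N = fun=> 0); first exact: Fmeas_cst (sF _ (leq0n n)).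
    by apply/funext => x; rewrite /M big_ord0.
  - have Fi : F i `<=` F i.+1 by apply: Fle; rewrite leqnSn.
    have [_ [mC _]] := XC i ni.
    rewrite MS; apply: FmeasD; first exact: sF.
      exact: Fmeas_sub (IH (ltnW ni)).
    apply: FmeasB; [exact: sF|exact: mX|exact: Fmeas_sub mC].
  - rewrite (_ : M 0%N = fun=> 0); first exact: integrable0.
    by apply/funext => x; rewrite /M big_ord0.
  - rewrite MS; exact: (integrableD measurableT (IH (ltnW ni)) (XCi i ni)).
split=> //; split=> // i ni; split; first exact: Mi.
split; first exact: mM (ltnW ni).
split; first exact: Mi (ltnW ni).
move=> A FA; have mA : measurable A by exact: FT (ltnW ni) _ FA.
have [Xi [_ [Ci XCA]]] := XC i ni.
have sub (Z : T -> R) : P.-integrable setT (EFin \o Z) -> P.-integrable A (EFin \o Z).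
  exact: integrableS.
change (\int[P]_(x in A) (M i x)%:E = \int[P]_(x in A) (M i.+1 x)%:E)%E.
rewrite MS.
rewrite (integralD mA (sub _ (Mi i (ltnW ni))) (sub _ (XCi i ni))).
rewrite (integralB mA (sub _ Xi) (sub _ Ci)) XCA// subee ?adde0//.
exact: integrable_fin_num (sub _ Xi).
Qed.

End Doob.

(** * Backward induction and assembly of the theorem *)

Lemma down_ind (Q : nat -> Prop) (n : nat) : Q n ->
  (forall i, (i < n)%N -> Q i.+1 -> Q i) -> forall i, (i <= n)%N -> Q i.
Proof.
move=> Qn QS i ni; rewrite -(subKn ni); move: (n - i)%N (leq_subr i n) => {ni}.
elim=> [_|k IH kn]; first by rewrite subn0.
by apply: QS; [rewrite ltn_subrL//= (leq_trans _ kn)|rewrite subnSK//; exact/IH/ltnW].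
Qed.

(** [theta_rec] counts the steps left until [n]; here its recursion is put in terms of the time
    index. *)
Lemma theta_upS {d : measure_display} {T : measurableType d} {R : realType}
    (n D : nat) (S : nat -> T -> \bar R) (f : nat -> T -> R -> 'rV[R]_D -> R)
    (alpha0 : nat -> T -> R) (beta : 'I_D -> nat -> T -> R) (Delta : nat -> R)
    (M0 : nat -> T -> R) (M : 'I_D -> nat -> T -> R) (i : nat) (x : T) :
  (i < n)%N -> theta_up n S f alpha0 beta Delta M0 M i x =
    theta_step S f alpha0 beta Delta M0 M i x
      (theta_up n S f alpha0 beta Delta M0 M i.+1 x).
Proof.
by move=> ni; rewrite /theta_up -(subnSK ni) /= subnSK// subKn// ltnW.
Qed.

Lemma ae_forall_ord {d : measure_display} {T : measurableType d} {R : realType}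
    (P : probability T R) (D : nat) (Q : 'I_D -> T -> Prop) :
  (forall k, {ae P, forall x, Q k x}) -> {ae P, forall x, forall k, Q k x}.
Proof. by move=> QP; apply: filter_forall. Qed.

Theorem theorem3p1
  (d : measure_display) (T : measurableType d) (R : realType)
  (P : probability T R)
  (n D : nat) (hn : (1 <= n)%N) (hD : (1 <= D)%N)
  (F : nat -> set (set T)) (hF : filtration n F)
  (Delta : nat -> R) (hDelta : forall i, (i < n)%N -> 0 < Delta i)
  (S : nat -> T -> \bar R)
  (hS_adapt : forall i, (i <= n)%N -> Fmeas_e (F i) (S i))
  (hS_ninf : forall i x, (i <= n)%N -> S i x != +oo%E)
  (hSn : forall x, S n x \is a fin_num)
  (hS_int : forall i, (i <= n)%N -> (\int[P]_x `|fine (S i x)|%:E < +oo)%E)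
  (f : nat -> T -> R -> 'rV[R]_D -> R)
  (hf_meas : forall i y z, (i < n)%N -> Fmeas (F i) (fun x => f i x y z))
  (hf_int : forall i, (i < n)%N -> (\int[P]_x `|f i x 0 0|%:E < +oo)%E)
  (alpha0 : nat -> T -> R) (alpha : 'I_D -> nat -> T -> R)
  (halpha0 : forall i, (i < n)%N ->
     Fmeas (F i) (alpha0 i) /\ forall x, 0 <= alpha0 i x)
  (halpha : forall k i, (i < n)%N ->
     Fmeas (F i) (alpha k i) /\ forall x, 0 <= alpha k i x)
  (hLip : forall i x y y' (z z' : 'rV[R]_D), (i < n)%N ->
     `|f i x y z - f i x y' z'|
       <= alpha0 i x * `|y - y'| + \sum_(k < D) alpha k i x * `|z ord0 k - z' ord0 k|)
  (beta : 'I_D -> nat -> T -> R)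
  (hbeta_adapt : forall k i, (1 <= i <= n)%N -> Fmeas (F i) (beta k i))
  (hbeta_bdd : exists K : R, forall k i x, (1 <= i <= n)%N -> `|beta k i x| <= K)
  (ha0 : forall i, (i < n)%N -> {ae P, forall x, alpha0 i x < (Delta i)^-1})
  (hab : forall i, (i < n)%N ->
     {ae P, forall x, \sum_(k < D) alpha k i x * `|beta k i.+1 x| <= (Delta i)^-1})
  (hconv : forall i x, (i < n)%N -> forall y y' (z z' : 'rV[R]_D) (l : R),
     0 <= l <= 1 ->
     f i x (l * y + (1 - l) * y') (l *: z + (1 - l) *: z')
       <= l * f i x y z + (1 - l) * f i x y' z')
  (Y : nat -> T -> R)
  (hY_adapt : forall i, (i <= n)%N -> Fmeas (F i) (Y i))
  (hY_int : forall i, (i <= n)%N -> P.-integrable setT (EFin \o Y i))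
  (hYn : {ae P, forall x, (Y n x)%:E = S n x})
  (hYrec : forall i, (i < n)%N ->
     exists (C : T -> R) (G : 'I_D -> T -> R),
       cexp P (F i) (Y i.+1) C /\
       (forall k, cexp P (F i) (fun x => beta k i.+1 x * Y i.+1 x) (G k)) /\
       {ae P, forall x, (Y i x)%:E =
          Order.max (S i x) ((C x + f i x (Y i x) (\row_(k < D) G k x) * Delta i)%:E)}) :
  (forall i, (i <= n)%N ->
    (forall M0 M, MartClass P n F alpha Delta M0 M ->
       forall C, gcexp P (F i) (theta_up n S f alpha0 beta Delta M0 M i) C ->
       {ae P, forall x, ((Y i x)%:E <= C x)%E}) /\
    (forall Z : T -> \bar R, measurable_fun setT Z ->
       (forall M0 M, MartClass P n F alpha Delta M0 M ->
          forall C, gcexp P (F i) (theta_up n S f alpha0 beta Delta M0 M i) C ->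
          {ae P, forall x, (Z x <= C x)%E}) ->
       {ae P, forall x, (Z x <= (Y i x)%:E)%E}))
  /\
  (forall (C0 : nat -> T -> R) (C : 'I_D -> nat -> T -> R),
     (forall j, (j < n)%N -> cexp P (F j) (Y j.+1) (C0 j)) ->
     (forall k j, (j < n)%N ->
        cexp P (F j) (fun x => beta k j.+1 x * Y j.+1 x) (C k j)) ->
     let Ms0 := fun i x => \sum_(j < i) (Y j.+1 x - C0 j x) in
     let Ms := fun k i x => \sum_(j < i) (beta k j.+1 x * Y j.+1 x - C k j x) in
     MartClass P n F alpha Delta Ms0 Ms /\
     (forall i, (i <= n)%N ->
        {ae P, forall x, theta_up n S f alpha0 beta Delta Ms0 Ms i x = Y i x})).
Proof.
have [sF [FT Fle]] := hF.
have FS i : (i < n)%N -> F i `<=` F i.+1 by move=> ni; apply: Fle; rewrite leqnSn.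
have lower M0 M : MartClass P n F alpha Delta M0 M -> forall i, (i <= n)%N ->
    exists2 L : T -> R, cond_nonneg P (F i) L & {ae P, forall x,
      Y i x + L x <= theta_up n S f alpha0 beta Delta M0 M i x}.
  move=> [[_ [_ M0E]] [ME Mlty]]; apply: down_ind => [|i ni [L1 hL1 L1th]].
    exists (fun=> 0).
      apply: (ge0_cond_nonneg P (F n) (FT n (leqnn n))) => [|A _].
        exact: integrable0.
      exact: integral_ge0.
    by apply: filterS hYn => x YS; rewrite addr0 /theta_up subnn /= -YS.
  have [C [Z [YC [YZ Yrec]]]] := hYrec i ni.
  (* The class bounds only a double sum. Its terms are nonnegative and [Delta i > 0], so a single
     infinite integral would make the sum infinite. *)
  have aM k : (\int[P]_x (alpha k i x * `|M k i.+1 x - M k i x|)%:E < +oo)%E.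
    have t0 (k' : 'I_D) (j : 'I_n) : (0 <= (\int[P]_x (alpha k' j x *
        `|M k' j.+1 x - M k' j x|)%:E) * (Delta j)%:E)%E.
      rewrite mule_ge0//; last by rewrite lee_fin ltW// hDelta.
      have [_ a0] := halpha k' j (ltn_ord j).
      by apply: integral_ge0 => x _; rewrite lee_fin mulr_ge0.
    move: Mlty; rewrite (bigD1 k)//= (bigD1 (Ordinal ni))//= -addeA.
    have [->|] := eqVneq (\int[P]_x (alpha k i x * `|M k i.+1 x - M k i x|)%:E)%E
      +oo%E; last by move=> Iy _; rewrite ltey.
    rewrite gt0_mulye ?lte_fin ?hDelta// addye// -ltNye.
    apply: (@lt_le_trans _ _ 0%E); first exact: ltNy0.
    by rewrite adde_ge0// sume_ge0// => k' _; rewrite sume_ge0.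
  have [L0 hL0 L0th] := theta_lower_step P (F i) (F i.+1) (sF _ (ltnW ni)) (sF _ ni)
    (FS i ni) (FT _ ni) (f i) (alpha0 i) (fun k => alpha k i)
    (fun k => beta k i.+1) (Delta i) (S i) (Y i) (Y i.+1) C Z
    (M0 i) (M0 i.+1) (fun k => M k i) (fun k => M k i.+1) L1
    (hDelta i ni) (hS_adapt i (ltnW ni)) (fun y z => hf_meas i y z ni)
    (fun x y y' z z' => hLip i x y y' z z' ni) (fun x => hconv i x ni)
    (fun k => (halpha k i ni).1) (fun k => (halpha k i ni).2)
    (fun k => hbeta_adapt k i.+1 ni) (ha0 i ni) (hab i ni)
    (hY_adapt i (ltnW ni)) (hY_int i.+1 ni) YC YZ Yrec (M0E i ni)
    (fun k => (ME k).2.2 i ni) aM hL1.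
  exists L0 => //; apply: (filterS3 _ _ L0th L1th (ha0 i ni)) => x L0x th1 ax.
  rewrite theta_upS//; apply: (L0x _ _ th1).
  apply: (theta_stepE S f alpha0 alpha beta Delta M0 M i x) => //.
  - exact: hDelta.
  - exact/hS_ninf/ltnW.
  - by move=> *; exact: hLip.
have optimal (C0 : nat -> T -> R) (C : 'I_D -> nat -> T -> R) :
     (forall j, (j < n)%N -> cexp P (F j) (Y j.+1) (C0 j)) ->
     (forall k j, (j < n)%N ->
        cexp P (F j) (fun x => beta k j.+1 x * Y j.+1 x) (C k j)) ->
     let Ms0 := fun i x => \sum_(j < i) (Y j.+1 x - C0 j x) in
     let Ms := fun k i x => \sum_(j < i) (beta k j.+1 x * Y j.+1 x - C k j x) in
     MartClass P n F alpha Delta Ms0 Ms /\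
     (forall i, (i <= n)%N ->
        {ae P, forall x, theta_up n S f alpha0 beta Delta Ms0 Ms i x = Y i x}).
  move=> YC0 YC Ms0 Ms.
  have Ms0S i x : Ms0 i.+1 x - Ms0 i x = Y i.+1 x - C0 i x.
    by rewrite /Ms0 big_ord_recr /=; ring.
  have MsS k i x : Ms k i.+1 x - Ms k i x = beta k i.+1 x * Y i.+1 x - C k i x.
    by rewrite /Ms big_ord_recr /=; ring.
  split.
    split; first by apply: doob_martingale => // j jn; exact: hY_adapt.
    split=> [k|].
      apply: (doob_martingale P n F hF (fun j x => beta k j x * Y j x)) => // j jn.
        by apply: FmeasM; [exact: sF|exact: hbeta_adapt|exact: hY_adapt].
      exact: YC.
    apply: lte_sum_pinfty => k _; apply: lte_sum_pinfty => i _.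
    have ni := ltn_ord i.
    rewrite muleC; apply: lte_mul_pinfty => //; first by rewrite lee_fin ltW// hDelta.
    have [ma a0] := halpha k i ni.
    have abk : {ae P, forall x, alpha k i x * `|beta k i.+1 x| <= (Delta i)^-1}.
      apply: filterS (hab i ni) => x; apply: le_trans.
      rewrite (bigD1 k)//= lerDl sumr_ge0// => j _; rewrite mulr_ge0//.
      exact: (halpha j i ni).2.
    (* The class condition for the Doob martingale of [beta Y] comes from the bound on
       [alpha |beta|], through the weighted integrability of its increments. *)
    have := integrable_weighted_cexp P (F i) (sF _ (ltnW ni)) (FT _ (ltnW ni))
      _ _ _ _ _ ma a0 (hY_int i.+1 ni) abk (YC k i ni).
    move/integrableP => [_]; congr (_ < _)%E; apply: eq_integral => x _ /=.
    by rewrite MsS normrM ger0_norm.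
  apply: down_ind => [|i ni thY].
    by apply: filterS hYn => x YS; rewrite /theta_up subnn /= -YS.
  have [C' [Z [YC' [YZ Yrec]]]] := hYrec i ni.
  (* The Doob martingales are built from arbitrary versions of the conditional expectations, while
     the recursion of [Y] comes with its own; they agree almost surely. *)
  have C0E := cexp_unique P (F i) (sF _ (ltnW ni)) (FT _ (ltnW ni)) _ _ _ (YC0 i ni) YC'.
  have CE := ae_forall_ord P D _ (fun k => cexp_unique P (F i) (sF _ (ltnW ni))
    (FT _ (ltnW ni)) _ _ _ (YC k i ni) (YZ k)).
  near=> x.
  rewrite theta_upS//.
  have -> : theta_up n S f alpha0 beta Delta Ms0 Ms i.+1 x = Y i.+1 x by near: x.
  apply: (theta_step_unique S f alpha0 alpha); [exact: hDelta|exact/hS_ninf/ltnW| | |].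
  - by near: x; exact: ha0.
  - by move=> *; exact: hLip.
  rewrite Ms0S subKr.
  have -> : C0 i x = C' x by near: x.
  have CEx : forall k, C k i x = Z k x by near: x.
  rewrite (_ : \row__ _ = \row_k Z k x); first by near: x.
  by apply/rowP => k; rewrite !mxE MsS subKr.
split; last exact: optimal.
move=> i ni; split=> [M0 M MM C thC|Z mZ ZC].
  have [L hL Lth] := lower M0 M MM i ni.
  exact: (gcexp_ge P (F i) (sF _ ni) (FT _ ni) _ _ _ _
    (hY_adapt i ni) (hY_int i ni) hL Lth).
(* The recursion provides versions time by time; a whole sequence is chosen, with 0 as filler from
   time [n] on. *)
have /choice[C0 YC0] : forall j, exists c : T -> R, (j < n)%N ->
    cexp P (F j) (Y j.+1) c.
  move=> j; have [jn|_] := ltnP j n; last by exists (fun=> 0).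
  by have [C [_ [? _]]] := hYrec j jn; exists C.
have /choice[C YC] : forall p : 'I_D * nat, exists c : T -> R, (p.2 < n)%N ->
    cexp P (F p.2) (fun x => beta p.1 p.2.+1 x * Y p.2.+1 x) c.
  move=> [k j] /=; have [jn|_] := ltnP j n; last by exists (fun=> 0).
  by have [_ [G [_ [? _]]]] := hYrec j jn; exists (G k).
have [MM thY] := optimal C0 (fun k j => C (k, j)) YC0 (fun k j => YC (k, j)).
(* The Doob pair attains the infimum, with [Y i] as its generalized conditional expectation, so a
   lower bound of the whole family lies below [Y i]. *)
apply: (ZC _ _ MM (EFin \o Y i)).
exact: (gcexp_ae_eq P (F i) (sF _ ni) _ _ (hY_adapt i ni) (hY_int i ni) (thY i ni)).
Unshelve. all: end_near.
Qed.
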